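(* Suppose that $\{\gamma_n\}_{n\ge0}$ is a bounded monotone increasing sequence of real numbers, not identically zero, with $\gamma_0=0$ and $\gamma_n\nearrow M<\infty$, satisfying $$\gamma_{n+2}-2\gamma_{n+1}+\gamma_n\le 0\quad\text{for all } n\ge 0\qquad\text{and}\qquad \sum_{n\ge0}(M-\gamma_n)<\infty.$$ Let $F\in\mathcal{H}^2$, $F\not\equiv0$, have zeros inside the unit disc $\mathbb{D}$ labeled in increasing order of magnitude $\alpha_j$, $j\in J$ (finitely or infinitely many, listed with multiplicity), and let $F=B\cdot G$ be its Blaschke decomposition. Then $$\sum_{j\in J}(1-|\alpha_j|^2)\left\|\frac{F(e^{i\cdot})}{e^{i\cdot}-\alpha_j}\right\|_{Y_\gamma}^2<\infty$$ and $$\|G(e^{i\cdot})\|_{X_\gamma}^2\le\|F(e^{i\cdot})\|_{X_\gamma}^2-\sum_{j\in J}\left((1-|\alpha_j|^2)\left\|\frac{F(e^{i\cdot})}{e^{i\cdot}-\alpha_j}\right\|_{Y_\gamma}^2\right).$$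
   Context: $\mathbb{D}$ is the open unit disc and $\mathcal{H}^2=\mathcal{H}^2(\mathbb{D})$ is the Hardy space of analytic functions $F(z)=\sum_{n\ge0}a_nz^n$ on $\mathbb{D}$ with $\|F\|_{\mathcal{H}^2}^2=\sum_{n\ge0}|a_n|^2<\infty$. ''Monotone increasing'' means nondecreasing, and $\gamma_n\nearrow M$ means that $\gamma_n$ is nondecreasing with limit $M$. For $F(z)=\sum_{j\ge0}a_jz^j\in\mathcal{H}^2$ put $$\|F\|_{X_\gamma}^2=\sum_{j\ge0}\gamma_j|a_j|^2,\qquad \|F\|_{Y_\gamma}^2=\sum_{j\ge0}(\gamma_{j+1}-\gamma_j)|a_j|^2.$$ A function $h(e^{i\cdot})$ on the circle is identified with the analytic function $h(z)$ on $\mathbb{D}$ of which it is the boundary function; norms are computed from the Taylor coefficients of $h$. In particular $\frac{F(e^{i\cdot})}{e^{i\cdot}-\alpha_j}$ stands for $z\mapsto F(z)/(z-\alpha_j)$, analytic in $\mathbb{D}$ after removing the singularity at $\alpha_j$. Blaschke decomposition: every $F\in\mathcal{H}^2$, $F\not\equiv0$, factors as $F=B\cdot G$, where $B$ is the (finite or infinite) Blaschke product whose zeros in $\mathbb{D}$ are those of $F$ with the same multiplicities, and $G\in\mathcal{H}^2$ has no zeros in $\mathbb{D}$. $B$ and $G$ are determined up to a unimodular constant, which does not affect the norms. *)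

(* Defs.v *)
From Stdlib Require Import Reals Arith List ClassicalEpsilon.
From Coquelicot Require Import Coquelicot.
Open Scope R_scope.

Definition in_disc (z : C) : Prop := Cmod z < 1.

(* Functions on the disc are total functions C -> C whose values outside the
   disc are irrelevant. *)
Definition has_taylor (f : C -> C) (a : nat -> C) : Prop :=
  forall z : C, in_disc z -> @is_pseries C_AbsRing C_NormedModule a z (f z).

Definition analytic (f : C -> C) : Prop := exists a : nat -> C, has_taylor f a.

(* The Taylor coefficients at 0 are unique when f is analytic; they are
   unspecified otherwise. *)
Definition taylor (f : C -> C) : nat -> C :=
  epsilon (inhabits (fun _ : nat => RtoC 0)) (has_taylor f).

Definition hardy2 (f : C -> C) : Prop :=
  analytic f /\ ex_series (fun n => Cmod (taylor f n) ^ 2).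

(* Both squared norms are convergent series as soon as f is in the Hardy space
   and gamma is bounded. *)
Definition normX2 (gamma : nat -> R) (f : C -> C) : R :=
  Series (fun j => gamma j * Cmod (taylor f j) ^ 2).

Definition normY2 (gamma : nat -> R) (f : C -> C) : R :=
  Series (fun j => (gamma (S j) - gamma j) * Cmod (taylor f j) ^ 2).

(* z |-> f z / (z - alpha) with the singularity at alpha removed: the analytic
   function on the disc agreeing with the quotient off alpha. It exists when
   f is analytic and f alpha = 0, and is unique on the disc. *)
Definition divided (f : C -> C) (alpha : C) : C -> C :=
  epsilon (inhabits f)
    (fun h => analytic h /\
       forall z : C, in_disc z -> z <> alpha -> h z = (f z / (z - alpha))%C).

(* f has a zero of order exactly m at z (m = 0 meaning f z <> 0). *)
Definition zero_order (f : C -> C) (z : C) (m : nat) : Prop :=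
  exists h : C -> C, analytic h /\ h z <> RtoC 0 /\
    forall w : C, in_disc w -> f w = (Cpow (w - z) m * h w)%C.

(* Index sets J are initial segments of nat: {0, ..., n-1} for Some n, and all
   of nat for None. *)
Definition in_index (J : option nat) (j : nat) : bool :=
  match J with
  | Some n => Nat.ltb j n
  | None => true
  end.

(* (alpha j), j in J, lists the zeros of f in the disc, each repeated according
   to its multiplicity. *)
Definition lists_zeros (f : C -> C) (J : option nat) (alpha : nat -> C) : Prop :=
  (forall j, in_index J j = true -> in_disc (alpha j)) /\
  (forall z : C, in_disc z ->
     exists l : list nat,
       NoDup l /\
       (forall j, In j l <-> in_index J j = true /\ alpha j = z) /\
       zero_order f z (length l)).

Definition increasing_modulus (J : option nat) (alpha : nat -> C) : Prop :=
  forall i j, (i <= j)%nat -> in_index J j = true ->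
    Cmod (alpha i) <= Cmod (alpha j).

Definition blaschke_factor (a z : C) : C :=
  if Ceq_dec a (RtoC 0) then z
  else (RtoC (Cmod a) / a * ((a - z) / (RtoC 1 - Cconj a * z)))%C.

Fixpoint blaschke_partial (J : option nat) (alpha : nat -> C) (n : nat) (z : C)
  : C :=
  match n with
  | O => RtoC 1
  | S k =>
      (blaschke_partial J alpha k z *
       (if in_index J k then blaschke_factor (alpha k) z else RtoC 1))%C
  end.

(* B is the Blaschke product with zeros (alpha j), j in J, up to a unimodular
   constant. For finite J the partial products are eventually constant. *)
Definition is_blaschke (J : option nat) (alpha : nat -> C) (B : C -> C) : Prop :=
  exists c : C, Cmod c = 1 /\
    forall z : C, in_disc z ->
      filterlim (fun n => (c * blaschke_partial J alpha n z)%C)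
        eventually (locally (B z)).

Definition blaschke_decomposition
  (F : C -> C) (J : option nat) (alpha : nat -> C) (B G : C -> C) : Prop :=
  is_blaschke J alpha B /\
  hardy2 G /\
  (forall z : C, in_disc z -> G z <> RtoC 0) /\
  (forall z : C, in_disc z -> F z = (B z * G z)%C).

Definition zero_term
  (gamma : nat -> R) (F : C -> C) (J : option nat) (alpha : nat -> C) (j : nat)
  : R :=
  if in_index J j
  then (1 - Cmod (alpha j) ^ 2) * normY2 gamma (divided F (alpha j))
  else 0.

(* Main.v *)
(* Write F = (z - al) h. Dividing F by the Blaschke factor at al gives, up to a
   unimodular constant, (1 - conj al z) h, and coefficientwise
     |((z - al) h)_n|^2 - |((1 - conj al z) h)_n|^2
       = (1 - |al|^2) (|h_{n-1}|^2 - |h_n|^2).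
   Summing against weights w_n turns this into (1 - |al|^2) times the norm of h
   with weights w_{n+1} - w_n. With w = gamma it is the exact drop of the X-norm
   when one zero is removed; with w_n = gamma_{n+1} - gamma_n, which decreases by
   concavity, it shows that removing other zeros first can only increase the
   Y-norm of the quotient at a given zero; with w = 1 it keeps the H^2-norm fixed.
   Removing all zeros one by one and passing to the limit with Fatou's lemma
   yields the inequality. *)

Require Import Defs.
From Stdlib Require Import Reals Arith Lra Lia List Classical ClassicalEpsilon.
From Coquelicot Require Import Coquelicot.
Open Scope R_scope.

(** The argument runs on coefficient sequences: multiplying by [p z + q] becomes [lin p q], and
    common linear factors are cancelled by [lin_inj], so the quotients by zeros need no function
    theory at the removed singularity. Two points carry the difficulty. First, after some factors
    have been divided out, the remaining function must still vanish at each remaining zero, although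
    [zero_order] speaks of F alone. This is settled by counting: the indices already used at a point
    together with the next one form a duplicate-free part of the list giving the multiplicity, so a
    positive power of the linear factor survives and a limit towards the point gives the zero.
    Second, the stripped functions converge to G, up to a unimodular constant, only pointwise and
    only where F does not vanish, whereas the norms see coefficients. The constant H^2-norm bounds
    all coefficients of all stripped functions at once, and under such a bound convergence at points
    arbitrarily close to 0 forces convergence of each coefficient. *)

(** * Limits of complex sequences through the modulus *)

Definition cv (u : nat -> C) (l : C) : Prop :=
  is_lim_seq (fun n => Cmod (u n - l)) 0.

Definition pser (a : nat -> C) (z l : C) : Prop :=
  @is_pseries C_AbsRing C_NormedModule a z l.

Definition psum (a : nat -> C) (z : C) (n : nat) : C :=
  @sum_n C_AbelianMonoid (fun k => a k * Cpow z k)%C n.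

Lemma psum_0 a z : psum a z 0 = a 0%nat.
Proof. unfold psum. rewrite sum_O. simpl. ring. Qed.

Lemma psum_S a z n : psum a z (S n) = (psum a z n + a (S n) * Cpow z (S n))%C.
Proof. unfold psum. rewrite sum_Sn. reflexivity. Qed.

(** Two uniform structures on the complex numbers are in play, the product one and the one given by
    the modulus; [locally_C] says that they have the same neighbourhoods. *)
Lemma cv_filterlim u l :
  cv u l <-> filterlim u eventually (@locally C_UniformSpace l).
Proof.
  split; intros H.
  - intros P HP. apply (proj1 (locally_C l P)) in HP.
    destruct HP as [eps He].
    apply is_lim_seq_spec in H. destruct (H eps) as [N HN].
    exists N. intros n Hn. apply He.
    specialize (HN n Hn). rewrite Rminus_0_r, Rabs_pos_eq in HN; [exact HN | apply Cmod_ge_0].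
  - apply is_lim_seq_spec. intros eps.
    assert (HP : @locally (AbsRing_UniformSpace C_AbsRing) l (fun y => Cmod (y - l) < eps)).
    { exists eps. intros y Hy. exact Hy. }
    apply locally_C in HP.
    destruct (H _ HP) as [N HN]. exists N. intros n Hn.
    rewrite Rminus_0_r, Rabs_pos_eq; [apply HN; exact Hn | apply Cmod_ge_0].
Qed.

Lemma pser_cv a z l : pser a z l <-> cv (psum a z) l.
Proof.
  rewrite cv_filterlim. unfold pser, is_pseries, is_series.
  assert (E : forall n, @sum_n C_AbelianMonoid (fun k => @scal C_AbsRing C_NormedModule (@pow_n C_AbsRing z k) (a k)) n = psum a z n).
  { intros n. unfold psum. apply sum_n_ext. intros k.
    change (@pow_n C_AbsRing z k * a k = a k * Cpow z k)%C.
    assert (Ep : @pow_n C_AbsRing z k = Cpow z k).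
    { induction k as [|k IH]; [reflexivity|]. simpl. rewrite IH. reflexivity. }
    rewrite Ep. ring. }
  split; apply filterlim_ext; intros n; [|symmetry]; exact (E n).
Qed.

Lemma is_lim_seq_squeeze0 (u v : nat -> R) :
  (forall n, 0 <= u n <= v n) -> is_lim_seq v 0 -> is_lim_seq u 0.
Proof.
  intros H Hv. apply (is_lim_seq_le_le (fun _ => 0) u v 0 H); [apply is_lim_seq_const | exact Hv].
Qed.

Lemma cv_le u l (e : nat -> R) :
  (forall n, Cmod (u n - l) <= e n) -> is_lim_seq e 0 -> cv u l.
Proof.
  intros H He. apply (is_lim_seq_squeeze0 _ e); [|exact He].
  intros n. split; [apply Cmod_ge_0 | apply H].
Qed.

Lemma cv_const l : cv (fun _ => l) l.
Proof.
  apply (cv_le _ _ (fun _ => 0)); [|apply is_lim_seq_const].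
  intros n. replace (l - l)%C with (RtoC 0) by ring. rewrite Cmod_0. lra.
Qed.

Lemma cv_ext u v l : (forall n, u n = v n) -> cv u l -> cv v l.
Proof.
  intros E. apply is_lim_seq_ext. intros n. rewrite E. reflexivity.
Qed.

Lemma cv_incr u l : cv (fun n => u (S n)) l <-> cv u l.
Proof.
  unfold cv. rewrite <- (is_lim_seq_incr_1 (fun n => Cmod (u n - l))). reflexivity.
Qed.

Lemma cv_plus u v l m : cv u l -> cv v m -> cv (fun n => u n + v n)%C (l + m)%C.
Proof.
  intros Hu Hv.
  apply (cv_le _ _ (fun n => Cmod (u n - l) + Cmod (v n - m))).
  - intros n. replace (u n + v n - (l + m))%C with ((u n - l) + (v n - m))%C by ring.
    apply Cmod_triangle.
  - replace (Finite 0) with (Finite (0 + 0)) by (f_equal; ring).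
    apply is_lim_seq_plus'; assumption.
Qed.

Lemma cv_mult u v l m : cv u l -> cv v m -> cv (fun n => u n * v n)%C (l * m)%C.
Proof.
  intros Hu Hv.
  apply (cv_le _ _ (fun n => Cmod (u n - l) * Cmod (v n - m)
           + Cmod l * Cmod (v n - m) + Cmod m * Cmod (u n - l))).
  - intros n. rewrite <- !Cmod_mult.
    replace (u n * v n - l * m)%C
      with ((u n - l) * (v n - m) + l * (v n - m) + m * (u n - l))%C by ring.
    eapply Rle_trans; [apply Cmod_triangle|].
    apply Rplus_le_compat_r, Cmod_triangle.
  - replace (Finite 0) with (Finite (0 * 0 + Cmod l * 0 + Cmod m * 0)) by (f_equal; ring).
    repeat apply is_lim_seq_plus'.
    + apply is_lim_seq_mult'; assumption.
    + apply (is_lim_seq_scal_l _ _ 0); assumption.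
    + apply (is_lim_seq_scal_l _ _ 0); assumption.
Qed.

Lemma cv_scal c u l : cv u l -> cv (fun n => c * u n)%C (c * l)%C.
Proof. intros H. apply cv_mult; [apply cv_const | exact H]. Qed.

Lemma cv_minus u v l m : cv u l -> cv v m -> cv (fun n => u n - v n)%C (l - m)%C.
Proof.
  intros Hu Hv.
  apply (cv_ext (fun n => u n + (-1) * v n)%C); [intros n; ring|].
  replace (l - m)%C with (l + (-1) * m)%C by ring.
  apply cv_plus; [exact Hu | apply cv_scal, Hv].
Qed.

Lemma cv_Cmod u l : cv u l -> is_lim_seq (fun n => Cmod (u n)) (Cmod l).
Proof.
  intros H.
  assert (T : forall x y, Cmod x - Cmod y <= Cmod (x - y)).
  { intros x y. pose proof (Cmod_triangle (x - y) y) as E.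
    replace (x - y + y)%C with x in E by ring. lra. }
  apply (is_lim_seq_le_le (fun n => Cmod l - Cmod (u n - l)) _ (fun n => Cmod l + Cmod (u n - l))).
  - intros n. pose proof (T (u n) l). pose proof (T l (u n)) as T2.
    replace (l - u n)%C with (- (u n - l))%C in T2 by ring. rewrite Cmod_opp in T2. lra.
  - replace (Finite (Cmod l)) with (Finite (Cmod l - 0)) by (f_equal; ring).
    apply is_lim_seq_minus'; [apply is_lim_seq_const | exact H].
  - replace (Finite (Cmod l)) with (Finite (Cmod l + 0)) by (f_equal; ring).
    apply is_lim_seq_plus'; [apply is_lim_seq_const | exact H].
Qed.

Lemma Cminus_eq0 (x y : C) : (x - y)%C = 0 -> x = y.
Proof. intros H. replace x with ((x - y) + y)%C by ring. rewrite H. ring. Qed.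

Lemma cv_unique u l m : cv u l -> cv u m -> l = m.
Proof.
  intros Hl Hm. apply Cminus_eq0, Cmod_eq_0.
  pose proof (cv_Cmod _ _ (cv_minus _ _ _ _ Hl Hm)) as H.
  apply is_lim_seq_unique in H.
  rewrite (Lim_seq_ext _ (fun _ => 0)) in H.
  - rewrite Lim_seq_const in H. injection H. auto.
  - intros n. replace (u n - u n)%C with (RtoC 0) by ring. apply Cmod_0.
Qed.

Lemma cv_pow w l n : cv w l -> cv (fun k => Cpow (w k) n) (Cpow l n).
Proof.
  intros H. induction n as [|n IH]; simpl; [apply cv_const | apply cv_mult; assumption].
Qed.

Lemma cv_inv (u : nat -> C) (l : C) : l <> 0 -> (forall n, u n <> 0) -> cv u l -> cv (fun n => / u n)%C (/ l)%C.
Proof.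
  intros Hl Hu H. pose proof (proj1 (Cmod_gt_0 l) Hl) as Hl'.
  apply (cv_le _ _ (fun n => Cmod (u n - l) * (/ Cmod (u n) * / Cmod l))).
  - intros n. rewrite <- !Cmod_inv by auto. rewrite <- !Cmod_mult.
    rewrite <- Cmod_opp.
    replace (- (/ u n - / l))%C with ((u n - l) * (/ u n * / l))%C; [lra|].
    field. split; auto.
  - replace (Finite 0) with (Finite (0 * (/ Cmod l * / Cmod l))) by (f_equal; ring).
    apply is_lim_seq_mult'; [exact H|].
    apply is_lim_seq_mult'; [|apply is_lim_seq_const].
    apply (is_lim_seq_inv _ (Cmod l)); [apply cv_Cmod, H|].
    intros E. injection E. lra.
Qed.

(** * Power series in the disc: products with linear factors, tails, continuity *)

Definition l2 (a : nat -> C) : Prop := ex_series (fun n => Cmod (a n) ^ 2).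

Lemma pser_unique a z l m : pser a z l -> pser a z m -> l = m.
Proof. rewrite !pser_cv. apply cv_unique. Qed.

Lemma pser_ext a b z l : (forall n, a n = b n) -> pser a z l -> pser b z l.
Proof. intros E. apply is_pseries_ext. exact E. Qed.

(* The coefficients of z |-> (p z + q) h(z). *)
Definition lin (p q : C) (h : nat -> C) (n : nat) : C :=
  (p * (match n with O => 0 | S k => h k end) + q * h n)%C.

Lemma pser_lin p q h z v : pser h z v -> pser (lin p q h) z ((p * z + q) * v)%C.
Proof.
  intros H.
  pose proof (is_pseries_plus _ _ _ _ _
    (is_pseries_scal p _ z _ (Cmult_comm _ _) (is_pseries_incr_1 h z v H))
    (is_pseries_scal q _ z _ (Cmult_comm _ _) H)) as E.
  replace ((p * z + q) * v)%C with (p * (z * v) + q * v)%C by ring.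
  exact E.
Qed.

Lemma is_lim_seq_geom_scal (c t : R) : 0 <= t < 1 -> is_lim_seq (fun n => c * t ^ n) 0.
Proof.
  intros Ht. replace (Finite 0) with (Rbar_mult c 0) by (simpl; f_equal; ring).
  apply is_lim_seq_scal_l, is_lim_seq_geom. rewrite Rabs_pos_eq; lra.
Qed.

Lemma pser_tail a z v K t N : 0 <= t < 1 ->
  (forall k, Cmod (a k * Cpow z k) <= K * t ^ k) -> pser a z v ->
  Cmod (v - psum a z N) <= K * t ^ S N / (1 - t).
Proof.
  intros Ht Ha Hv. apply pser_cv in Hv.
  assert (HK : 0 <= K).
  { pose proof (Ha 0%nat) as H0. simpl pow in H0.
    pose proof (Cmod_ge_0 (a 0%nat * Cpow z 0)). lra. }
  (* The exact finite geometric sum, rather than its limit, is what makes the induction on [m]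
     close. *)
  assert (B : forall m, Cmod (psum a z (m + N) - psum a z N) <= K * (t ^ S N - t ^ (S (m + N))) / (1 - t)).
  { induction m as [|m IH].
    - replace (psum a z (0 + N) - psum a z N)%C with (RtoC 0) by (simpl; ring).
      rewrite Cmod_0. simpl. apply Req_le. field. lra.
    - simpl (S m + N)%nat. rewrite psum_S.
      replace (psum a z (m + N) + a (S (m + N)) * z ^ S (m + N) - psum a z N)%C
        with ((psum a z (m + N) - psum a z N) + a (S (m + N)) * z ^ S (m + N))%C by ring.
      eapply Rle_trans; [apply Cmod_triangle|].
      pose proof (Ha (S (m + N))) as H1.
      replace (K * (t ^ S N - t ^ S (S (m + N))) / (1 - t)) with
        (K * (t ^ S N - t ^ (S (m + N))) / (1 - t) + K * t ^ (S (m + N))).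
      + lra.
      + simpl. field. lra. }
  assert (L : is_lim_seq (fun m => Cmod (psum a z (m + N) - psum a z N)) (Cmod (v - psum a z N))).
  { apply cv_Cmod, cv_minus; [|apply cv_const].
    unfold cv. apply (is_lim_seq_incr_n (fun n => Cmod (psum a z n - v)) N). exact Hv. }
  apply (is_lim_seq_le _ (fun _ => K * t ^ S N / (1 - t)) _ (K * t ^ S N / (1 - t))) in L;
    [exact L | | apply is_lim_seq_const].
  intros m. eapply Rle_trans; [apply B|].
  apply Rmult_le_compat_r; [left; apply Rinv_0_lt_compat; lra|].
  apply Rmult_le_compat_l; [exact HK|].
  assert (0 <= t ^ S (m + N)) by (apply pow_le; lra). lra.
Qed.

Lemma pser_bound a z v K t : 0 <= t < 1 ->
  (forall k, Cmod (a k * Cpow z k) <= K * t ^ k) -> pser a z v ->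
  Cmod v <= K / (1 - t).
Proof.
  intros Ht Ha Hv.
  pose proof (pser_tail a z v K t 0 Ht Ha Hv) as H. rewrite psum_0 in H.
  pose proof (Ha 0%nat) as H0. simpl in H0.
  replace (a 0%nat * 1)%C with (a 0%nat) in H0 by ring.
  pose proof (Cmod_triangle (v - a 0%nat) (a 0%nat)) as T.
  replace (v - a 0%nat + a 0%nat)%C with v in T by ring.
  replace (K / (1 - t)) with (K * t ^ 1 / (1 - t) + K * 1) by (simpl; field; lra).
  lra.
Qed.

Lemma pser_ex a z K t : 0 <= t < 1 ->
  (forall k, Cmod (a k * Cpow z k) <= K * t ^ k) -> exists v, pser a z v.
Proof.
  intros Ht Ha.
  assert (E : @ex_series C_AbsRing C_NormedModule (fun k => a k * Cpow z k)%C).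
  { apply (@ex_series_le C_AbsRing C_CompleteNormedModule _ (fun k => K * t ^ k)).
    - exact Ha.
    - apply (ex_series_scal_l K (fun k => t ^ k)), ex_series_geom. rewrite Rabs_pos_eq; lra. }
  destruct E as [v Hv]. exists v. apply pser_cv, cv_filterlim. exact Hv.
Qed.

(* Value at z of the series, junk where it diverges. *)
Definition ev (a : nat -> C) (z : C) : C :=
  epsilon (inhabits (RtoC 0)) (pser a z).

Lemma bounded_pow a K z : (forall n, Cmod (a n) <= K) ->
  forall k, Cmod (a k * Cpow z k) <= K * Cmod z ^ k.
Proof.
  intros H k. rewrite Cmod_mult, Cmod_pow. apply Rmult_le_compat_r; [|apply H].
  apply pow_le, Cmod_ge_0.
Qed.

Lemma ev_spec a K z : (forall n, Cmod (a n) <= K) -> in_disc z -> pser a z (ev a z).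
Proof.
  intros H Hz. apply (epsilon_spec (inhabits (RtoC 0)) (pser a z)).
  apply (pser_ex a z K (Cmod z)); [split; [apply Cmod_ge_0 | exact Hz]|].
  apply bounded_pow, H.
Qed.

Lemma cv0_bounded u l : cv u l -> exists K, forall n, Cmod (u n) <= K.
Proof.
  intros H. apply cv_Cmod in H.
  destruct (filterlim_bounded (fun n => Cmod (u n)) (ex_intro _ (Cmod l) H)) as [K HK].
  exists K. intros n. eapply Rle_trans; [|apply HK]. apply Rle_abs.
Qed.

(** Each term is a difference of two consecutive partial sums, and these are bounded by [K]; hence
    the factor 2. *)
Lemma pser_coef_bound a z v : pser a z v -> exists K, forall n, Cmod (a n * Cpow z n) <= K.
Proof.
  intros H. apply pser_cv in H. destruct (cv0_bounded _ _ H) as [K HK].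
  exists (2 * K). intros [|n].
  - pose proof (HK 0%nat) as H0. rewrite psum_0 in H0. simpl.
    replace (a 0%nat * 1)%C with (a 0%nat) by ring. pose proof (Cmod_ge_0 (a 0%nat)). lra.
  - pose proof (HK n). pose proof (HK (S n)) as H1. rewrite psum_S in H1.
    pose proof (Cmod_triangle (psum a z n + a (S n) * z ^ S n) (- psum a z n)) as T.
    replace (psum a z n + a (S n) * z ^ S n + - psum a z n)%C with (a (S n) * z ^ S n)%C in T by ring.
    rewrite Cmod_opp in T. lra.
Qed.

(** Convergence at the point [s] halfway between [rho] and 1 bounds [a k * s ^ k]; the ratio
    [t = rho / s] then serves the whole closed disc of radius [rho]. *)
Lemma taylor_geom f a rho : has_taylor f a -> 0 <= rho < 1 ->
  exists K t, 0 <= t < 1 /\ forall z, Cmod z <= rho -> forall k, Cmod (a k * Cpow z k) <= K * t ^ k.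
Proof.
  intros H Hr. set (s := (1 + rho) / 2).
  assert (Hs : in_disc (RtoC s)).
  { unfold in_disc. rewrite Cmod_R, Rabs_pos_eq; unfold s; lra. }
  destruct (pser_coef_bound _ _ _ (H _ Hs)) as [K HK].
  exists K, (rho / s). split.
  - split; [apply Rdiv_le_0_compat; unfold s; lra|].
    apply Rmult_lt_reg_r with s; [unfold s; lra|].
    replace (rho / s * s) with rho by (field; unfold s; lra). unfold s; lra.
  - intros z Hz k. specialize (HK k). rewrite Cmod_mult, Cmod_pow in *.
    rewrite Cmod_R, Rabs_pos_eq in HK by (unfold s; lra).
    assert (Hz' : Cmod z ^ k <= rho ^ k) by (apply pow_incr; split; [apply Cmod_ge_0|exact Hz]).
    apply Rle_trans with (Cmod (a k) * rho ^ k).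
    + apply Rmult_le_compat_l; [apply Cmod_ge_0 | exact Hz'].
    + unfold Rdiv. rewrite Rpow_mult_distr, pow_inv.
      replace (Cmod (a k) * rho ^ k) with (Cmod (a k) * s ^ k * (rho ^ k * / s ^ k)).
      * apply Rmult_le_compat_r; [|exact HK].
        apply Rmult_le_pos; [apply pow_le; lra|].
        left. apply Rinv_0_lt_compat, pow_lt. unfold s; lra.
      * field. apply pow_nonzero. unfold s; lra.
Qed.

(** An eps/3 argument: [rho] lies halfway between [Cmod beta] and 1, so almost all [w n] share one
    geometric tail bound with [beta], and the partial sum of the fixed degree [N] is a
    polynomial. *)
Lemma taylor_continuous f a beta w : has_taylor f a -> in_disc beta ->
  (forall n, in_disc (w n)) -> cv w beta -> cv (fun n => f (w n)) (f beta).
Proof.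
  intros Hf Hb Hw Hcv. set (rho := (1 + Cmod beta) / 2).
  unfold in_disc in Hb. pose proof (Cmod_ge_0 beta) as Hb0.
  destruct (taylor_geom f a rho Hf ltac:(unfold rho; lra)) as (K & t & Ht & HK).
  assert (Hev : eventually (fun n => Cmod (w n) <= rho)).
  { assert (Hd : 0 < (1 - Cmod beta) / 2) by lra.
    pose proof Hcv as Hcv'. apply is_lim_seq_spec in Hcv'.
    destruct (Hcv' (mkposreal _ Hd)) as [N HN]. exists N. intros n Hn.
    specialize (HN n Hn). simpl in HN. rewrite Rminus_0_r, Rabs_pos_eq in HN by apply Cmod_ge_0.
    pose proof (Cmod_triangle (w n - beta) beta) as T.
    replace (w n - beta + beta)%C with (w n) in T by ring. unfold rho. lra. }
  apply is_lim_seq_spec. intros eps.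
  assert (He3 : 0 < eps / 3) by (destruct eps; simpl; lra).
  assert (Htail : is_lim_seq (fun N => K * t ^ S N / (1 - t)) 0).
  { apply (is_lim_seq_ext (fun N => (K * t / (1 - t)) * t ^ N)).
    - intros n. simpl. field. lra.
    - apply is_lim_seq_geom_scal. exact Ht. }
  apply is_lim_seq_spec in Htail. destruct (Htail (mkposreal _ He3)) as [N HN].
  specialize (HN N (le_n N)). simpl in HN. rewrite Rminus_0_r in HN.
  assert (Hp : cv (fun n => psum a (w n) N) (psum a beta N)).
  { clear HN. induction N as [|N IH].
    - apply (cv_ext (fun _ => a 0%nat)); [intros n; rewrite psum_0; reflexivity|].
      rewrite psum_0. apply cv_const.
    - apply (cv_ext (fun n => psum a (w n) N + a (S N) * Cpow (w n) (S N))%C);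
        [intros n; rewrite psum_S; reflexivity|].
      rewrite psum_S. apply cv_plus; [exact IH|]. apply cv_scal, cv_pow, Hcv. }
  apply is_lim_seq_spec in Hp.
  generalize (filter_and _ _ Hev (Hp (mkposreal _ He3))). apply filter_imp.
  intros n [H1 H2]. simpl in H2. rewrite Rminus_0_r, Rabs_pos_eq in * by apply Cmod_ge_0.
  pose proof (pser_tail a (w n) (f (w n)) K t N Ht (HK _ H1) (Hf _ (Hw n))) as T1.
  pose proof (pser_tail a beta (f beta) K t N Ht (HK beta ltac:(unfold rho; lra)) (Hf _ Hb)) as T2.
  apply Rabs_lt_between in HN.
  replace (f (w n) - f beta)%C with
    ((f (w n) - psum a (w n) N) + ((psum a (w n) N - psum a beta N) + - (f beta - psum a beta N)))%C by ring.
  eapply Rle_lt_trans; [apply Cmod_triangle|].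
  pose proof (Cmod_triangle (psum a (w n) N - psum a beta N) (- (f beta - psum a beta N))) as T3.
  rewrite Cmod_opp in T3. simpl in *. lra.
Qed.

(** * Recovering coefficients from values near the origin *)

Lemma pser_minus a b z v w : pser a z v -> pser b z w -> pser (fun n => a n - b n)%C z (v - w)%C.
Proof.
  intros Ha Hb.
  exact (is_pseries_plus _ _ _ _ _ Ha (is_pseries_opp _ _ _ Hb)).
Qed.

(* Induction on k: divided by |z|^k, the tail beyond degree k is O(|z|) uniformly
   in n. *)
Lemma coef_limit (d : nat -> nat -> C) (K T : R) :
  0 < T -> (forall n k, Cmod (d n k) <= K * T ^ k) ->
  (forall rho, 0 < rho -> exists z v, 0 < Cmod z < rho /\
      (forall n, pser (d n) z (v n)) /\ cv v 0) ->
  forall k, cv (fun n => d n k) 0.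
Proof.
  intros HT Hd Hz.
  assert (HK : 0 <= K).
  { pose proof (Hd 0%nat 0%nat) as H. simpl in H. pose proof (Cmod_ge_0 (d 0%nat 0%nat)). lra. }
  induction k as [k IH] using (well_founded_induction lt_wf).
  apply is_lim_seq_spec. intros eps.
  assert (HQ : 0 <= 2 * K * T ^ S k).
  { apply Rmult_le_pos; [lra | apply pow_le; lra]. }
  set (Q := 2 * K * T ^ S k) in *.
  assert (He : 0 < eps) by apply cond_pos.
  (* The first radius gives [T * Cmod z <= 1 / 2], so the geometric tail costs at most the factor 2
     contained in [Q]. The second makes the error [Q * Cmod z] smaller than [eps / 2]; the added 1
     keeps the denominator positive when [Q] is 0. *)
  destruct (Hz (Rmin (/ (2 * T)) (eps / 2 / (Q + 1)))) as (z & v & [Hz0 Hz1] & Hv & Hcv).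
  { apply Rmin_pos; [apply Rinv_0_lt_compat; lra|].
    apply Rdiv_lt_0_compat; lra. }
  assert (Hza : T * Cmod z <= 1 / 2).
  { apply Rle_trans with (T * / (2 * T)).
    - apply Rmult_le_compat_l; [lra|]. pose proof (Rmin_l (/ (2 * T)) (eps / 2 / (Q + 1))). lra.
    - apply Req_le. field. lra. }
  assert (Hzb : Q * Cmod z < eps / 2).
  { apply Rle_lt_trans with (Q * (eps / 2 / (Q + 1))).
    - apply Rmult_le_compat_l; [exact HQ|]. pose proof (Rmin_r (/ (2 * T)) (eps / 2 / (Q + 1))). lra.
    - apply Rmult_lt_reg_r with (Q + 1); [lra|].
      replace (Q * (eps / 2 / (Q + 1)) * (Q + 1)) with (Q * (eps / 2)) by (field; lra). lra. }
  assert (Hp : 0 < Cmod z ^ k) by (apply pow_lt; exact Hz0).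
  assert (Hlow : cv (fun n => psum (d n) z k - d n k * Cpow z k)%C 0).
  { assert (G : forall j, (j < k)%nat -> cv (fun n => psum (d n) z j) 0).
    { induction j as [|j IHj]; intros Hj.
      - apply (cv_ext (fun n => d n 0%nat)); [intros n; rewrite psum_0; reflexivity | apply IH, Hj].
      - apply (cv_ext (fun n => psum (d n) z j + Cpow z (S j) * d n (S j))%C).
        + intros n. rewrite psum_S. ring.
        + replace (RtoC 0) with (0 + Cpow z (S j) * 0)%C by ring.
          apply cv_plus; [apply IHj; lia | apply cv_scal, IH, Hj]. }
    destruct k as [|k].
    - apply (cv_ext (fun _ => RtoC 0)); [|apply cv_const]. intros n. rewrite psum_0. simpl. ring.
    - apply (cv_ext (fun n => psum (d n) z k)); [|apply G; lia]. intros n. rewrite psum_S. ring. }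
  assert (Hsum : is_lim_seq (fun n => (Cmod (v n) + Cmod (psum (d n) z k - d n k * Cpow z k)%C) * / Cmod z ^ k) 0).
  { replace (Finite 0) with (Finite ((Cmod 0 + Cmod 0) * / Cmod z ^ k)) by (rewrite Cmod_0; f_equal; ring).
    apply is_lim_seq_mult'; [|apply is_lim_seq_const].
    apply is_lim_seq_plus'; apply cv_Cmod; assumption. }
  apply is_lim_seq_spec in Hsum.
  assert (He2 : 0 < eps / 2) by lra.
  generalize (Hsum (mkposreal _ He2)). apply filter_imp. intros n Hn. simpl in Hn.
  rewrite Rminus_0_r in *. apply Rabs_lt_between in Hn.
  rewrite Rabs_pos_eq by apply Cmod_ge_0.
  replace (d n k - 0)%C with (d n k) by ring.
  assert (Ht : 0 <= T * Cmod z < 1) by (split; [apply Rmult_le_pos|]; lra).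
  pose proof (pser_tail (d n) z (v n) K (T * Cmod z) k Ht) as Tl.
  assert (Hb : forall j, Cmod (d n j * Cpow z j) <= K * (T * Cmod z) ^ j).
  { intros j. rewrite Cmod_mult, Cmod_pow, Rpow_mult_distr, <- Rmult_assoc.
    apply Rmult_le_compat_r; [apply pow_le, Cmod_ge_0 | apply Hd]. }
  specialize (Tl Hb (Hv n)).
  assert (Tl' : Cmod (v n - psum (d n) z k) <= Q * Cmod z * Cmod z ^ k).
  { eapply Rle_trans; [exact Tl|]. unfold Rdiv.
    apply Rle_trans with (K * (T * Cmod z) ^ S k * 2).
    - apply Rmult_le_compat_l; [apply Rmult_le_pos; [exact HK | apply pow_le; lra]|].
      rewrite <- (Rinv_inv 2). apply Rinv_le_contravar; lra.
    - rewrite Rpow_mult_distr. unfold Q. simpl. apply Req_le. ring. }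
  assert (Hm : Cmod (d n k) * Cmod z ^ k <= Cmod (v n) + Cmod (psum (d n) z k - d n k * Cpow z k)%C + Q * Cmod z * Cmod z ^ k).
  { rewrite <- Cmod_pow, <- Cmod_mult.
    replace (d n k * Cpow z k)%C with
      (v n + (- (v n - psum (d n) z k) + - (psum (d n) z k - d n k * Cpow z k)))%C at 1 by ring.
    eapply Rle_trans; [apply Cmod_triangle|].
    pose proof (Cmod_triangle (- (v n - psum (d n) z k)) (- (psum (d n) z k - d n k * Cpow z k))) as T3.
    rewrite !Cmod_opp in T3. rewrite Cmod_pow. lra. }
  apply Rmult_lt_reg_r with (Cmod z ^ k); [exact Hp|].
  eapply Rle_lt_trans; [exact Hm|].
  assert (Hn2 : Cmod (v n) + Cmod (psum (d n) z k - d n k * Cpow z k)%C < eps / 2 * Cmod z ^ k).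
  { apply Rmult_lt_reg_r with (/ Cmod z ^ k); [apply Rinv_0_lt_compat, Hp|].
    replace (eps / 2 * Cmod z ^ k * / Cmod z ^ k) with (eps / 2) by (field; lra). lra. }
  assert (Q * Cmod z * Cmod z ^ k < eps / 2 * Cmod z ^ k) by (apply Rmult_lt_compat_r; assumption).
  lra.
Qed.

Lemma in_disc_R r : 0 <= r < 1 -> in_disc (RtoC r).
Proof. intros H. unfold in_disc. rewrite Cmod_R, Rabs_pos_eq; lra. Qed.

(** Convergence at the point 1/2 yields the growth rate 2, the form of bound that [coef_limit]
    takes. *)
Lemma taylor_coef_bound f a : has_taylor f a -> exists K, 0 <= K /\ forall k, Cmod (a k) <= K * 2 ^ k.
Proof.
  intros H. destruct (pser_coef_bound _ _ _ (H (RtoC (1 / 2)) (in_disc_R (1 / 2) ltac:(lra)))) as [K HK].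
  exists K. split; [eapply Rle_trans; [apply Cmod_ge_0 | apply (HK 0%nat)]|].
  intros k. specialize (HK k). rewrite Cmod_mult, Cmod_pow, Cmod_R, Rabs_pos_eq in HK by lra.
  apply Rmult_le_reg_r with ((1 / 2) ^ k); [apply pow_lt; lra|].
  rewrite Rmult_assoc, <- Rpow_mult_distr. replace (2 * (1 / 2)) with 1 by field.
  rewrite pow1. lra.
Qed.

(** The identity theorem at the origin, as the case of a constant family in [coef_limit]. *)
Lemma pser_const0 (a : nat -> C) (K : R) :
  (forall k, Cmod (a k) <= K * 2 ^ k) ->
  (forall rho, 0 < rho -> exists z, 0 < Cmod z < rho /\ pser a z 0) ->
  forall k, a k = 0.
Proof.
  intros HK Hz k. apply (cv_unique (fun _ => a k)); [apply cv_const|].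
  apply (coef_limit (fun _ => a) K 2); [lra | intros _; exact HK|].
  intros rho Hr. destruct (Hz rho Hr) as (z & H1 & H2). exists z, (fun _ => RtoC 0).
  repeat split; try apply H1; [intros _; exact H2 | apply cv_const].
Qed.

Lemma small_point rho : 0 < rho -> exists z, 0 < Cmod z < rho /\ in_disc z.
Proof.
  intros H. exists (RtoC (Rmin (rho / 2) (1 / 2))). unfold in_disc.
  assert (0 < Rmin (rho / 2) (1 / 2)) by (apply Rmin_pos; lra).
  pose proof (Rmin_l (rho / 2) (1 / 2)). pose proof (Rmin_r (rho / 2) (1 / 2)).
  rewrite Cmod_R, Rabs_pos_eq; lra.
Qed.

Lemma taylor_unique f a b : has_taylor f a -> has_taylor f b -> forall n, a n = b n.
Proof.
  intros Ha Hb n. apply Cminus_eq0.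
  destruct (taylor_coef_bound _ _ Ha) as (K1 & _ & H1), (taylor_coef_bound _ _ Hb) as (K2 & _ & H2).
  apply (pser_const0 (fun n => a n - b n)%C (K1 + K2)).
  - intros k. unfold Cminus. eapply Rle_trans; [apply Cmod_triangle|]. rewrite Cmod_opp.
    specialize (H1 k). specialize (H2 k). lra.
  - intros rho Hr. destruct (small_point rho Hr) as (z & Hz & Hd). exists z. split; [exact Hz|].
    replace (RtoC 0) with (f z - f z)%C by ring. apply pser_minus; [apply Ha, Hd | apply Hb, Hd].
Qed.

(** Supplies the test points for [coef_limit]: where F is nonzero, so are all partial Blaschke
    products and their limit, and one may divide by them. If no such points existed near 0, all
    coefficients would vanish. *)
Lemma taylor_nonvanishing f a : has_taylor f a -> (exists z, in_disc z /\ f z <> 0) ->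
  forall rho, 0 < rho -> exists z, 0 < Cmod z < rho /\ in_disc z /\ f z <> 0.
Proof.
  intros Hf (z0 & Hd & Hne) rho Hr. apply NNPP. intros Hn.
  destruct (taylor_coef_bound _ _ Hf) as (K & _ & HK).
  assert (Ha : forall k, a k = 0).
  { apply (pser_const0 a K HK). intros r Hr0.
    destruct (small_point (Rmin rho r) (Rmin_pos _ _ Hr Hr0)) as (z & Hz & Hdz).
    pose proof (Rmin_l rho r). pose proof (Rmin_r rho r).
    exists z. split; [lra|].
    replace (RtoC 0) with (f z); [apply Hf, Hdz|].
    apply NNPP. intros E. apply Hn. exists z. repeat split; try lra; assumption. }
  apply Hne. apply (pser_unique a z0); [apply Hf, Hd|].
  apply pser_cv. apply (cv_ext (fun _ => RtoC 0)); [|apply cv_const].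
  intros n. induction n as [|n IH]; [rewrite psum_0, Ha; reflexivity|].
  rewrite psum_S, <- IH, Ha. ring.
Qed.

(** * Square-summable sequences and weighted series *)

Lemma ex_series_bounded (u : nat -> R) B :
  (forall n, 0 <= u n) -> (forall n, sum_n u n <= B) -> ex_series u.
Proof.
  intros Hu HB.
  destruct (ex_finite_lim_seq_incr (sum_n u) B) as [l Hl].
  - intros n. rewrite sum_Sn. unfold plus; simpl. specialize (Hu (S n)). lra.
  - exact HB.
  - exists l. exact Hl.
Qed.

Lemma sum_n_le_Series (u : nat -> R) n :
  (forall k, 0 <= u k) -> ex_series u -> sum_n u n <= Series u.
Proof.
  intros Hu He.
  apply (is_lim_seq_incr_compare (sum_n u)); [apply Series_correct, He|].
  intros k. rewrite sum_Sn. unfold plus; simpl. specialize (Hu (S k)). lra.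
Qed.

Lemma Series_nonneg (u : nat -> R) : (forall k, 0 <= u k) -> ex_series u -> 0 <= Series u.
Proof.
  intros Hu He. eapply Rle_trans; [|apply (sum_n_le_Series u 0 Hu He)].
  rewrite sum_O. apply Hu.
Qed.

Lemma Cmod_sq_ge0 z : 0 <= Cmod z ^ 2.
Proof. apply pow_le, Cmod_ge_0. Qed.

(** The bound 1 plus the sum of squares comes from [t <= 1 + t ^ 2], which avoids a square root. *)
Lemma l2_bounded a : l2 a -> exists K, forall n, Cmod (a n) <= K.
Proof.
  intros H. exists (1 + Series (fun n => Cmod (a n) ^ 2)). intros n.
  assert (Hs : Cmod (a n) ^ 2 <= Series (fun n => Cmod (a n) ^ 2)).
  { eapply Rle_trans; [|apply (sum_n_le_Series _ n); [intros; apply Cmod_sq_ge0 | exact H]].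
    destruct n; [rewrite sum_O; lra|]. rewrite sum_Sn. unfold plus; simpl.
    assert (0 <= sum_n (fun n => Cmod (a n) ^ 2) n); [|simpl in *; lra].
    clear. induction n; [rewrite sum_O; apply Cmod_sq_ge0|]. rewrite sum_Sn.
    unfold plus; simpl. pose proof (Cmod_sq_ge0 (a (S n))). simpl in *. lra. }
  pose proof (Cmod_ge_0 (a n)). nra.
Qed.

Lemma l2_weight (w : nat -> R) W a : (forall n, Rabs (w n) <= W) -> l2 a ->
  ex_series (fun n => w n * Cmod (a n) ^ 2).
Proof.
  intros Hw Ha.
  apply (@ex_series_le R_AbsRing R_CompleteNormedModule _ (fun n => W * Cmod (a n) ^ 2)).
  - intros n. change (Rabs (w n * Cmod (a n) ^ 2) <= W * Cmod (a n) ^ 2).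
    rewrite Rabs_mult, (Rabs_pos_eq (_ ^ 2)) by apply Cmod_sq_ge0.
    apply Rmult_le_compat_r; [apply Cmod_sq_ge0 | apply Hw].
  - apply (ex_series_scal_l W (fun n => Cmod (a n) ^ 2)), Ha.
Qed.

Lemma l2_ext a b : (forall n, a n = b n) -> l2 a -> l2 b.
Proof. intros E. apply ex_series_ext. intros n. rewrite E. reflexivity. Qed.

(** Convexity of the square at the points [x / (1 - r)] and [y] with weights [1 - r] and [r]. The
    factor left on [y ^ 2] is below 1, so it can be absorbed when such estimates are summed. *)
Lemma convex_sq (r x y z : R) : 0 <= r < 1 -> 0 <= x -> 0 <= y -> 0 <= z -> z <= x + r * y ->
  z ^ 2 <= / (1 - r) * x ^ 2 + r * y ^ 2.
Proof.
  intros Hr Hx Hy Hz H.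
  apply Rle_trans with ((x + r * y) ^ 2); [apply pow_incr; lra|].
  assert (E : / (1 - r) * x ^ 2 + r * y ^ 2 - (x + r * y) ^ 2
    = r * / (1 - r) * (x - (1 - r) * y) ^ 2) by (field; lra).
  assert (0 <= r * / (1 - r) * (x - (1 - r) * y) ^ 2).
  { apply Rmult_le_pos; [|apply pow2_ge_0]. apply Rmult_le_pos; [lra|].
    left. apply Rinv_0_lt_compat. lra. }
  lra.
Qed.

Lemma sum_n_shift (u : nat -> R) n : sum_n u (S n) = u 0%nat + sum_n (fun k => u (S k)) n.
Proof.
  induction n as [|n IH].
  - rewrite sum_Sn, !sum_O. reflexivity.
  - rewrite sum_Sn, IH, (sum_Sn (fun k => u (S k))). unfold plus; simpl. ring.
Qed.

(* Squaring by convexity gives S_N <= C + r S_{N+1} for the partial sums of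
   |h_n|^2, and boundedness of h closes the estimate. *)
Lemma l2_rec_down a h r K : 0 <= r < 1 -> (forall n, Cmod (h n) <= K) -> l2 a ->
  (forall n, Cmod (h n) <= Cmod (a (S n)) + r * Cmod (h (S n))) -> l2 h.
Proof.
  intros Hr HK Ha H.
  set (A := Series (fun n => Cmod (a n) ^ 2)).
  assert (HS : forall N, (1 - r) * sum_n (fun n => Cmod (h n) ^ 2) N
                         <= / (1 - r) * A + r * K ^ 2).
  { intros N.
    assert (H1 : sum_n (fun n => Cmod (h n) ^ 2) N <=
       / (1 - r) * sum_n (fun n => Cmod (a (S n)) ^ 2) N + r * sum_n (fun n => Cmod (h (S n)) ^ 2) N).
    { induction N as [|N IH].
      - rewrite !sum_O. apply convex_sq; auto using Cmod_ge_0.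
      - rewrite !sum_Sn. unfold plus; simpl plus.
        pose proof (convex_sq r _ _ _ Hr (Cmod_ge_0 _) (Cmod_ge_0 _) (Cmod_ge_0 _) (H (S N))) as H2.
        unfold AbelianMonoid.plus; simpl in *. lra. }
    pose proof (sum_n_le_Series _ (S N) (fun n => Cmod_sq_ge0 (a n)) Ha) as H2. fold A in H2.
    rewrite sum_n_shift in H2. pose proof (Cmod_sq_ge0 (a 0%nat)) as P0.
    pose proof (sum_n_shift (fun n => Cmod (h n) ^ 2) N) as H3. rewrite sum_Sn in H3.
    change plus with Rplus in H3. pose proof (Cmod_sq_ge0 (h 0%nat)) as P1.
    assert (H4 : Cmod (h (S N)) ^ 2 <= K ^ 2) by (apply pow_incr; split; [apply Cmod_ge_0 | apply HK]).
    assert (H5 : / (1 - r) * sum_n (fun n => Cmod (a (S n)) ^ 2) N <= / (1 - r) * A).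
    { apply Rmult_le_compat_l; [left; apply Rinv_0_lt_compat; lra | lra]. }
    assert (H6 : r * sum_n (fun n => Cmod (h (S n)) ^ 2) N <= r * (sum_n (fun n => Cmod (h n) ^ 2) N + K ^ 2)).
    { apply Rmult_le_compat_l; lra. }
    lra. }
  apply (ex_series_bounded _ ((/ (1 - r) * A + r * K ^ 2) / (1 - r))); [intros; apply Cmod_sq_ge0|].
  intros N. apply Rmult_le_reg_l with (1 - r); [lra|].
  replace ((1 - r) * ((/ (1 - r) * A + r * K ^ 2) / (1 - r))) with (/ (1 - r) * A + r * K ^ 2) by (field; lra).
  apply HS.
Qed.

(** The estimate for dividing by [1 - Cconj al * z], whose coefficients obey a forward recursion
    with ratio [Cmod al]. *)
Lemma l2_rec_up g p r : 0 <= r < 1 -> l2 g ->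
  (forall n, Cmod (p (S n)) <= Cmod (g (S n)) + r * Cmod (p n)) -> l2 p.
Proof.
  intros Hr Hg H.
  set (A := Series (fun n => Cmod (g n) ^ 2)).
  (* The recursion bounds the sum up to [N] by [r] times the sum up to [N - 1], written here as the
     full sum minus its last term. *)
  assert (HS : forall N, sum_n (fun n => Cmod (p n) ^ 2) N
                         <= Cmod (p 0%nat) ^ 2 + / (1 - r) * sum_n (fun n => Cmod (g n) ^ 2) N + r * sum_n (fun n => Cmod (p n) ^ 2) N - r * Cmod (p N) ^ 2).
  { assert (0 <= / (1 - r)) by (left; apply Rinv_0_lt_compat; lra).
    induction N as [|N IH].
    - rewrite !sum_O. pose proof (Cmod_sq_ge0 (g 0%nat)).
      assert (0 <= / (1 - r) * Cmod (g 0%nat) ^ 2) by (apply Rmult_le_pos; assumption). lra.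
    - rewrite !sum_Sn. change plus with Rplus.
      pose proof (convex_sq r _ _ _ Hr (Cmod_ge_0 _) (Cmod_ge_0 _) (Cmod_ge_0 _) (H N)) as H2.
      lra. }
  apply (ex_series_bounded _ ((Cmod (p 0%nat) ^ 2 + / (1 - r) * A) / (1 - r))); [intros; apply Cmod_sq_ge0|].
  intros N. apply Rmult_le_reg_l with (1 - r); [lra|].
  replace ((1 - r) * ((Cmod (p 0%nat) ^ 2 + / (1 - r) * A) / (1 - r))) with (Cmod (p 0%nat) ^ 2 + / (1 - r) * A) by (field; lra).
  specialize (HS N).
  pose proof (sum_n_le_Series _ N (fun n => Cmod_sq_ge0 (g n)) Hg) as H2. fold A in H2.
  assert (/ (1 - r) * sum_n (fun n => Cmod (g n) ^ 2) N <= / (1 - r) * A).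
  { apply Rmult_le_compat_l; [left; apply Rinv_0_lt_compat; lra | lra]. }
  assert (0 <= r * Cmod (p N) ^ 2) by (apply Rmult_le_pos; [lra | apply Cmod_sq_ge0]).
  lra.
Qed.

Lemma l2_shift h : l2 h -> l2 (fun n => match n with O => RtoC 0 | S k => h k end).
Proof.
  intros H. unfold l2. apply (ex_series_incr_1 (fun n => Cmod (match n with O => RtoC 0 | S k => h k end) ^ 2)). exact H.
Qed.

Lemma l2_lin p q h : l2 h -> l2 (lin p q h).
Proof.
  intros H.
  apply (@ex_series_le R_AbsRing R_CompleteNormedModule _
    (fun n => (2 * Cmod p ^ 2) * Cmod (match n with O => RtoC 0 | S k => h k end) ^ 2
            + (2 * Cmod q ^ 2) * Cmod (h n) ^ 2)).
  - intros n. change (Rabs (Cmod (lin p q h n) ^ 2) <= (2 * Cmod p ^ 2) * Cmod (match n with O => RtoC 0 | S k => h k end) ^ 2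
            + (2 * Cmod q ^ 2) * Cmod (h n) ^ 2).
    rewrite Rabs_pos_eq by apply Cmod_sq_ge0. unfold lin.
    set (x := match n with O => RtoC 0 | S k => h k end).
    pose proof (Cmod_triangle (p * x) (q * h n)) as T. rewrite !Cmod_mult in T.
    apply Rle_trans with ((Cmod p * Cmod x + Cmod q * Cmod (h n)) ^ 2).
    + apply pow_incr. split; [apply Cmod_ge_0 | exact T].
    + pose proof (pow2_ge_0 (Cmod p * Cmod x - Cmod q * Cmod (h n))). nra.
  - apply (@ex_series_plus R_AbsRing R_NormedModule).
    + apply (ex_series_scal_l (2 * Cmod p ^ 2) (fun n => Cmod (match n with O => RtoC 0 | S k => h k end) ^ 2)), l2_shift, H.
    + apply (ex_series_scal_l (2 * Cmod q ^ 2) (fun n => Cmod (h n) ^ 2)), H.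
Qed.

(** * Cancelling linear factors and the weighted norm identity *)

Lemma lin_comm p q r s h n : lin p q (lin r s h) n = lin r s (lin p q h) n.
Proof. unfold lin. destruct n as [|[|n]]; ring. Qed.

Lemma lin_ext p q h h' : (forall n, h n = h' n) -> forall n, lin p q h n = lin p q h' n.
Proof. intros E n. unfold lin. destruct n; rewrite !E; reflexivity. Qed.

Lemma Cmult_cancel (c x y : C) : c <> 0 -> (c * x = c * y)%C -> x = y.
Proof.
  intros Hc E. replace x with (/ c * (c * x))%C by (field; exact Hc). rewrite E. field. exact Hc.
Qed.

(** If [q] is 0 the factor is a nonzero multiple of the shift; otherwise the coefficients are
    determined one after another from degree 0 upwards. *)
Lemma lin_inj (p q : C) h h' : p <> 0 \/ q <> 0 ->
  (forall n, lin p q h n = lin p q h' n) -> forall n, h n = h' n.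
Proof.
  intros Hpq E. destruct (Ceq_dec q 0) as [Hq|Hq].
  - destruct Hpq as [Hp|Hq']; [|contradiction]. intros n. specialize (E (S n)).
    unfold lin in E. rewrite Hq in E. apply (Cmult_cancel p); [exact Hp|].
    replace (p * h n)%C with (p * h n + 0 * h (S n))%C by ring. rewrite E. ring.
  - induction n as [|n IH].
    + specialize (E 0%nat). unfold lin in E. apply (Cmult_cancel q); [exact Hq|].
      replace (q * h 0%nat)%C with (p * 0 + q * h 0%nat)%C by ring. rewrite E. ring.
    + specialize (E (S n)). unfold lin in E. rewrite IH in E. apply (Cmult_cancel q); [exact Hq|].
      replace (q * h (S n))%C with (p * h' n + q * h (S n) - p * h' n)%C by ring. rewrite E. ring.
Qed.

Lemma Cmod_sq z : Cmod z ^ 2 = fst z ^ 2 + snd z ^ 2.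
Proof.
  unfold Cmod. rewrite pow2_sqrt; [reflexivity|].
  pose proof (pow2_ge_0 (fst z)). pose proof (pow2_ge_0 (snd z)). lra.
Qed.

(** With x and y the two neighbouring coefficients, |x - al y|^2 and |y - conj al x|^2 have the same
    cross term, because the products involved are complex conjugates of each other. *)
Lemma lin_coef_identity (al kap : C) h n : Cmod kap = 1 ->
  Cmod (lin 1 (- al) h n) ^ 2 - Cmod (lin (- kap * Cconj al) kap h n) ^ 2
  = (1 - Cmod al ^ 2) *
    (Cmod (match n with O => RtoC 0 | S k => h k end) ^ 2 - Cmod (h n) ^ 2).
Proof.
  intros Hk. unfold lin. set (x := match n with O => RtoC 0 | S k => h k end). set (y := h n).
  replace (- kap * Cconj al * x + kap * y)%C with (kap * (y - Cconj al * x))%C by ring.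
  rewrite Cmod_mult, Hk, Rmult_1_l, !Cmod_sq.
  destruct al, x, y. simpl. ring.
Qed.

(** A free weight lets one identity serve three norms: [gamma] gives the X-norm, its increments the
    Y-norm, and the constant 1 the H^2-norm. *)
Definition wnorm (w : nat -> R) (a : nat -> C) : R := Series (fun n => w n * Cmod (a n) ^ 2).

(** Summation by parts applied to [lin_coef_identity]; bounded weights and [l2 h] make each series
    converge separately, so that they may be split. *)
Lemma wnorm_lin_identity (w : nat -> R) W (al kap : C) h :
  (forall n, Rabs (w n) <= W) -> Cmod kap = 1 -> l2 h ->
  wnorm w (lin 1 (- al) h) - wnorm w (lin (- kap * Cconj al) kap h)
  = (1 - Cmod al ^ 2) * wnorm (fun n => w (S n) - w n) h.
Proof.
  intros Hw Hk Hh. unfold wnorm.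
  rewrite <- Series_minus by (apply (l2_weight w W); [exact Hw | apply l2_lin, Hh]).
  rewrite <- Series_scal_l.
  set (x := fun n => match n with O => RtoC 0 | S k => h k end).
  assert (Hx : ex_series (fun n => w n * Cmod (x n) ^ 2)).
  { apply (l2_weight w W); [exact Hw | apply l2_shift, Hh]. }
  assert (Hy : ex_series (fun n => w n * Cmod (h n) ^ 2)) by (apply (l2_weight w W); assumption).
  assert (Hy1 : ex_series (fun n => w (S n) * Cmod (h n) ^ 2)).
  { apply (l2_weight (fun n => w (S n)) W); [intros; apply Hw | assumption]. }
  rewrite (Series_ext _ (fun n => (1 - Cmod al ^ 2) * (w n * Cmod (x n) ^ 2 - w n * Cmod (h n) ^ 2))).
  2:{ intros n. rewrite <- Rmult_minus_distr_l, lin_coef_identity by exact Hk. unfold x. ring. }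
  rewrite !Series_scal_l. f_equal.
  rewrite Series_minus by assumption.
  (* The shifted sequence starts with 0, so dropping its first term turns the weight [w n] into
     [w (S n)] on the coefficients of [h]. *)
  rewrite (Series_incr_1 (fun n => w n * Cmod (x n) ^ 2)) by exact Hx.
  change (x 0%nat) with (RtoC 0). rewrite Cmod_0.
  rewrite (Series_ext (fun n => (w (S n) - w n) * Cmod (h n) ^ 2)
            (fun n => w (S n) * Cmod (h n) ^ 2 - w n * Cmod (h n) ^ 2)) by (intros; ring).
  rewrite Series_minus by assumption. simpl. ring.
Qed.

Lemma wnorm_ext w a b : (forall n, a n = b n) -> wnorm w a = wnorm w b.
Proof. intros E. apply Series_ext. intros n. rewrite E. reflexivity. Qed.

Lemma Cmod1_neq0 (k : C) : Cmod k = 1 -> k <> 0.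
Proof. intros H E. rewrite E, Cmod_0 in H. lra. Qed.

(* h is h' times a Blaschke factor; writing h' = kap (1 - conj al z) p reduces the
   claim to wnorm_lin_identity for p. *)
Lemma wnorm_blaschke_le (w : nat -> R) W (al kap : C) h h' :
  (forall n, Rabs (w n) <= W) -> (forall n, w (S n) <= w n) ->
  in_disc al -> Cmod kap = 1 -> l2 h' ->
  (forall n, lin (- kap * Cconj al) kap h n = lin 1 (- al) h' n) ->
  wnorm w h <= wnorm w h'.
Proof.
  intros Hw Hdec Hal Hk Hh' E. pose proof (Cmod1_neq0 _ Hk) as Hk0.
  set (p := fix p n := match n with O => (/ kap * h' 0%nat)%C
                       | S m => (/ kap * h' (S m) + Cconj al * p m)%C end).
  assert (Hp : forall n, h' n = lin (- kap * Cconj al) kap p n).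
  { intros [|n]; unfold lin; simpl; field; exact Hk0. }
  assert (Hp2 : l2 p).
  { apply (l2_rec_up h' p (Cmod al)); [split; [apply Cmod_ge_0 | exact Hal] | exact Hh'|].
    intros n. simpl p. eapply Rle_trans; [apply Cmod_triangle|].
    rewrite !Cmod_mult, Cmod_inv, Hk, Cmod_conj by exact Hk0. lra. }
  assert (Eh : forall n, h n = lin 1 (- al) p n).
  { apply (lin_inj (- kap * Cconj al) kap); [right; exact Hk0|]. intros n.
    rewrite E, lin_comm. apply lin_ext. exact Hp. }
  rewrite (wnorm_ext w h _ Eh), (wnorm_ext w h' _ Hp).
  pose proof (wnorm_lin_identity w W al kap p Hw Hk Hp2) as I.
  assert (N : 0 <= wnorm (fun n => w n - w (S n)) p).
  { apply Series_nonneg.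
    - intros n. apply Rmult_le_pos; [specialize (Hdec n); lra | apply Cmod_sq_ge0].
    - apply (l2_weight _ (W + W)); [|exact Hp2]. intros n.
      eapply Rle_trans; [apply Rabs_triang|]. rewrite Rabs_Ropp. apply Rplus_le_compat; apply Hw. }
  assert (N2 : wnorm (fun n => w (S n) - w n) p = - wnorm (fun n => w n - w (S n)) p).
  { unfold wnorm. rewrite <- Series_opp. apply Series_ext. intros n. ring. }
  unfold in_disc in Hal. pose proof (Cmod_ge_0 al).
  assert (0 <= 1 - Cmod al ^ 2) by nra.
  rewrite N2 in I. nra.
Qed.

(** * Dividing a square-summable series by a linear factor at a zero *)

Lemma pser_decr a z v : pser (fun j => a (S j)) z v -> pser a z (a 0%nat + z * v)%C.
Proof.
  rewrite !pser_cv. intros H. apply cv_incr.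
  apply (cv_ext (fun n => a 0%nat + z * psum (fun j => a (S j)) z n)%C).
  - intros n. cbv beta. induction n as [|n IH].
    + rewrite psum_S, !psum_0. simpl. ring.
    + rewrite (psum_S a z (S n)), <- IH, psum_S, !Cpow_S. ring.
  - apply cv_plus; [apply cv_const | apply cv_scal, H].
Qed.

(* h_n = sum_j a_{n+1+j} al^j. *)
Lemma l2_divide a al : l2 a -> in_disc al -> pser a al 0 ->
  exists h, l2 h /\ forall n, a n = lin 1 (- al) h n.
Proof.
  intros Ha Hal H0. destruct (l2_bounded a Ha) as [K HK].
  set (h := fun n => ev (fun j => a (S n + j)%nat) al).
  assert (Hs : forall n, pser (fun j => a (S n + j)%nat) al (h n)).
  { intros n. apply (ev_spec _ K); [intros; apply HK | exact Hal]. }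
  assert (Hr : 0 <= Cmod al < 1) by (split; [apply Cmod_ge_0 | exact Hal]).
  assert (Hrec : forall n, h n = (a (S n) + al * h (S n))%C).
  { intros n. apply (pser_unique _ _ _ _ (Hs n)).
    replace (a (S n)) with (a (S n + 0)%nat) by (f_equal; lia).
    apply (pser_decr (fun j => a (S n + j)%nat)).
    eapply pser_ext; [|apply (Hs (S n))]. intros j. simpl. f_equal. lia. }
  exists h. split.
  - apply (l2_rec_down a h (Cmod al) (K / (1 - Cmod al)) Hr); [|exact Ha|].
    + intros n. apply (pser_bound (fun j => a (S n + j)%nat) al); [exact Hr | | apply Hs].
      apply bounded_pow. intros; apply HK.
    + intros n. rewrite (Hrec n) at 1. rewrite <- Cmod_mult. apply Cmod_triangle.
  - intros [|n]; unfold lin.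
    (* The equation in degree 0 is where the zero enters: [a 0 + al * h 0] is the value of the
       series at [al]. *)
    + replace (a 0%nat) with ((a 0%nat + al * h 0%nat) - al * h 0%nat)%C by ring.
      rewrite (pser_unique _ _ _ _ (pser_decr a al _ (Hs 0%nat)) H0). ring.
    + rewrite (Hrec n). ring.
Qed.

(** * Blaschke factors and orders of vanishing *)

Lemma Cinv_neq0 (x : C) : x <> 0 -> (/ x)%C <> 0.
Proof.
  intros Hx E. apply (Cmod1_neq0 1 Cmod_1). rewrite <- (Cinv_r x Hx), E. ring.
Qed.

(** The constant that turns the normalized Blaschke factor into (z - a) / (unim a (1 - conj a z)),
    with no case split on a = 0 left. *)
Definition unim (a : C) : C := if Ceq_dec a 0 then 1 else (- a / Cmod a)%C.

Lemma Cmod_unim a : Cmod (unim a) = 1.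
Proof.
  unfold unim. destruct (Ceq_dec a 0) as [E|E]; [apply Cmod_1|].
  pose proof (proj1 (Cmod_gt_0 a) E) as H.
  rewrite Cmod_div by (intros E'; apply RtoC_inj in E'; lra).
  rewrite Cmod_opp, Cmod_R, Rabs_pos_eq by lra. field. lra.
Qed.

Lemma one_minus_conj_neq0 a z : in_disc a -> in_disc z -> (1 - Cconj a * z)%C <> 0.
Proof.
  intros Ha Hz E. unfold in_disc in *.
  assert (E2 : (Cconj a * z)%C = 1) by (symmetry; apply Cminus_eq0, E).
  apply (f_equal Cmod) in E2. rewrite Cmod_mult, Cmod_conj, Cmod_1 in E2.
  pose proof (Cmod_ge_0 a). pose proof (Cmod_ge_0 z). nra.
Qed.

Lemma unim_lin_neq0 a z : in_disc a -> in_disc z ->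
  (- unim a * Cconj a * z + unim a)%C <> 0.
Proof.
  intros Ha Hz. replace (- unim a * Cconj a * z + unim a)%C with (unim a * (1 - Cconj a * z))%C by ring.
  apply Cmult_neq_0; [apply Cmod1_neq0, Cmod_unim | apply one_minus_conj_neq0; assumption].
Qed.

Lemma blaschke_factor_unim a z : in_disc a -> in_disc z ->
  (blaschke_factor a z * (- unim a * Cconj a * z + unim a))%C = (z - a)%C.
Proof.
  intros Ha Hz. pose proof (one_minus_conj_neq0 a z Ha Hz) as H.
  unfold blaschke_factor, unim. destruct (Ceq_dec a 0) as [E|E].
  - rewrite E. replace (Cconj 0) with (RtoC 0) by (apply injective_projections; simpl; ring). ring.
  - assert (Hm : RtoC (Cmod a) <> 0).
    { intros E'. apply RtoC_inj in E'. apply E, Cmod_eq_0, E'. }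
    field. repeat split; assumption.
Qed.

(** Test sequences stay in the disc because values outside it carry no meaning. *)
Definition seq_continuous_at (u : C -> C) (beta : C) : Prop :=
  forall w, (forall n, in_disc (w n)) -> cv w beta -> cv (fun n => u (w n)) (u beta).

(** The cofactor is kept merely continuous and nonzero at [beta]; this suffices for the limit in
    [order_gap_zero] and avoids expanding it in a power series. *)
Lemma blaschke_factor_unit a beta : in_disc a -> in_disc beta ->
  exists (e : nat) u, (forall z, in_disc z -> blaschke_factor a z = (Cpow (z - beta) e * u z)%C) /\
    u beta <> 0 /\ seq_continuous_at u beta /\ e = (if Ceq_dec a beta then 1 else 0)%nat.
Proof.
  intros Ha Hb.
  assert (Hc : seq_continuous_at (fun z => / (- unim a * Cconj a * z + unim a))%C beta).
  { intros w Hw Hcv. apply cv_inv; [apply unim_lin_neq0; assumption | intros n; apply unim_lin_neq0; auto |].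
    apply cv_plus; [|apply cv_const]. apply cv_scal, Hcv. }
  assert (Hf : forall z, in_disc z -> blaschke_factor a z = ((z - a) * / (- unim a * Cconj a * z + unim a))%C).
  { intros z Hz. rewrite <- blaschke_factor_unim by assumption. field. apply unim_lin_neq0; assumption. }
  assert (Hn : (/ (- unim a * Cconj a * beta + unim a))%C <> 0).
  { apply Cinv_neq0, unim_lin_neq0; assumption. }
  destruct (Ceq_dec a beta) as [E|E].
  - exists 1%nat, (fun z => / (- unim a * Cconj a * z + unim a))%C. repeat split; try assumption.
    intros z Hz. rewrite Hf, E, Cpow_1_r by assumption. reflexivity.
  - exists 0%nat, (fun z => (z - a) * / (- unim a * Cconj a * z + unim a))%C. repeat split.
    + intros z Hz. rewrite Hf by assumption. simpl. ring.
    + apply Cmult_neq_0; [|exact Hn]. intros E'. apply E. symmetry. apply Cminus_eq0, E'.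
    + intros w Hw Hcv. apply cv_mult; [|apply Hc; assumption].
      apply cv_minus; [exact Hcv | apply cv_const].
Qed.

(** The exponent of [z - beta] comes with the indices [l] that produce it, so that it can later be
    compared with a multiplicity by comparing lists. *)
Lemma blaschke_partial_order J alpha n beta :
  (forall j, in_index J j = true -> in_disc (alpha j)) -> in_disc beta ->
  exists l u, NoDup l /\
    (forall j, In j l -> (j < n)%nat /\ in_index J j = true /\ alpha j = beta) /\
    (forall z, in_disc z -> blaschke_partial J alpha n z = (Cpow (z - beta) (length l) * u z)%C) /\
    u beta <> 0 /\ seq_continuous_at u beta.
Proof.
  intros HJ Hb. induction n as [|n (l & u & Hl & Hin & Hu & Hne & Hc)].
  - exists nil, (fun _ => RtoC 1). repeat split; try solve [constructor | contradiction].
    + intros z Hz. simpl. ring.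
    + intros E. apply RtoC_inj in E. lra.
    + intros w _ _. apply cv_const.
  - simpl. destruct (in_index J n) eqn:EJ.
    + destruct (blaschke_factor_unit (alpha n) beta (HJ _ EJ) Hb) as (e & v & Hv & Hvne & Hvc & He).
      exists (if Ceq_dec (alpha n) beta then n :: l else l), (fun z => u z * v z)%C.
      assert (Hlen : length (if Ceq_dec (alpha n) beta then n :: l else l) = (length l + e)%nat).
      { rewrite He. destruct (Ceq_dec (alpha n) beta); simpl; lia. }
      repeat split.
      * destruct (Ceq_dec (alpha n) beta); [|exact Hl]. constructor; [|exact Hl].
        intros Hi. apply Hin in Hi. lia.
      * destruct (Ceq_dec (alpha n) beta); [destruct H as [H|H]|]; try (apply Hin in H); lia.
      * destruct (Ceq_dec (alpha n) beta); [destruct H as [H|H]|]; try (apply Hin in H);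
          [subst; exact EJ | apply H | apply H].
      * destruct (Ceq_dec (alpha n) beta) as [E|E]; [destruct H as [H|H]|]; try (apply Hin in H);
          [rewrite <- H; exact E | apply H | apply H].
      * intros z Hz. rewrite Hlen, Cpow_add_r, Hu, Hv by assumption. ring.
      * apply Cmult_neq_0; assumption.
      * intros w Hw Hcv. apply cv_mult; [apply Hc | apply Hvc]; assumption.
    + exists l, u. repeat split; try assumption.
      * apply Hin in H. lia.
      * apply Hin, H.
      * apply Hin, H.
      * intros z Hz. rewrite Hu by assumption. ring.
Qed.

Lemma approach beta : in_disc beta ->
  exists w, (forall n, in_disc (w n)) /\ (forall n, w n <> beta) /\ cv w beta.
Proof.
  intros Hb. unfold in_disc in Hb.
  set (e := fun n => (1 - Cmod beta) * (1 / 2) ^ S n).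
  assert (He : forall n, 0 < e n < 1 - Cmod beta).
  { intros n. unfold e. assert (0 < (1 / 2) ^ S n) by (apply pow_lt; lra).
    assert ((1 / 2) ^ S n < 1) by (apply pow_lt_1_compat; [lra | lia]). nra. }
  exists (fun n => beta + RtoC (e n))%C. repeat split.
  - intros n. unfold in_disc. eapply Rle_lt_trans; [apply Cmod_triangle|].
    specialize (He n). rewrite Cmod_R, Rabs_pos_eq; lra.
  - intros n E. assert (E2 : RtoC (e n) = 0).
    { replace (RtoC (e n)) with (beta + RtoC (e n) - beta)%C by ring. rewrite E. ring. }
    apply RtoC_inj in E2. specialize (He n). lra.
  - apply (cv_le _ _ (fun n => ((1 - Cmod beta) * (1 / 2)) * (1 / 2) ^ n)).
    + intros n. replace (beta + RtoC (e n) - beta)%C with (RtoC (e n)) by ring.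
      specialize (He n). rewrite Cmod_R, Rabs_pos_eq by lra. unfold e. simpl. lra.
    + apply is_lim_seq_geom_scal. lra.
Qed.

(** At [beta] itself the equation may read 0 = 0, so the power of order [p] is cancelled along a
    sequence avoiding [beta]; the remaining power [m - p] is positive and tends to 0. *)
Lemma order_gap_zero (f u v : C -> C) beta p m : in_disc beta -> (p < m)%nat ->
  seq_continuous_at f beta -> seq_continuous_at u beta -> u beta <> 0 -> analytic v ->
  (forall z, in_disc z -> (Cpow (z - beta) p * u z * f z = Cpow (z - beta) m * v z)%C) ->
  f beta = 0.
Proof.
  intros Hb Hpm Hf Hu Hne [b Hv] E.
  destruct (approach beta Hb) as (w & Hw & Hwne & Hcv).
  assert (E2 : forall n, (u (w n) * f (w n) = Cpow (w n - beta) (m - p) * v (w n))%C).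
  { intros n. apply (Cmult_cancel (Cpow (w n - beta) p)).
    - apply Cpow_nz. intros E0. apply (Hwne n), Cminus_eq0, E0.
    - rewrite Cmult_assoc, E, Cmult_assoc, <- Cpow_add_r by apply Hw.
      do 2 f_equal. lia. }
  apply (Cmult_cancel (u beta)); [exact Hne|].
  apply (cv_unique (fun n => u (w n) * f (w n))%C); [apply cv_mult; [apply Hu | apply Hf]; assumption|].
  apply (cv_ext (fun n => Cpow (w n - beta) (m - p) * v (w n))%C); [intros n; symmetry; apply E2|].
  replace (u beta * 0)%C with (Cpow (beta - beta) (m - p) * v beta)%C.
  - apply cv_mult; [apply cv_pow, cv_minus; [exact Hcv | apply cv_const]|].
    apply (taylor_continuous v b); assumption.
  - destruct (m - p)%nat eqn:Em; [lia|]. simpl. ring.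
Qed.

(** * Removing the zeros one by one *)

(* Coefficients of the quotient by z - al; junk unless the series a vanishes at al. *)
Definition quot (al : C) (a : nat -> C) : nat -> C :=
  epsilon (inhabits a) (fun h => l2 h /\ forall n, a n = lin 1 (- al) h n).

(* Coefficients of F divided by the first k Blaschke factors, a being those of F. *)
Fixpoint strip (J : option nat) (alpha : nat -> C) (a : nat -> C) (k : nat) : nat -> C :=
  match k with
  | O => a
  | S k => if in_index J k
           then lin (- unim (alpha k) * Cconj (alpha k)) (unim (alpha k))
                    (quot (alpha k) (strip J alpha a k))
           else strip J alpha a k
  end.

Lemma l2_pser a z : l2 a -> in_disc z -> pser a z (ev a z).
Proof. intros Ha. destruct (l2_bounded a Ha) as [K HK]. apply (ev_spec a K), HK. Qed.

Lemma quot_spec al a : l2 a -> in_disc al -> ev a al = 0 ->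
  l2 (quot al a) /\ forall n, a n = lin 1 (- al) (quot al a) n.
Proof.
  intros Ha Hal H0.
  apply (epsilon_spec (inhabits a) (fun h => l2 h /\ forall n, a n = lin 1 (- al) h n)).
  apply l2_divide; try assumption. rewrite <- H0. apply l2_pser; assumption.
Qed.

Lemma ev_lin p q h a z : l2 h -> in_disc z -> (forall n, a n = lin p q h n) ->
  ev a z = ((p * z + q) * ev h z)%C.
Proof.
  intros Hh Hz E. apply (pser_unique a z).
  - apply l2_pser; [|exact Hz]. apply (l2_ext (lin p q h)); [intros; symmetry; apply E | apply l2_lin, Hh].
  - apply (pser_ext (lin p q h)); [intros; symmetry; apply E|]. apply pser_lin, l2_pser; assumption.
Qed.

(** The first [k] factors contain [z - alpha k] fewer times than the multiplicity of this zero in F,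
    so the cofactor must supply the rest. *)
Lemma strip_zero F J alpha a k : lists_zeros F J alpha -> in_index J k = true ->
  l2 (strip J alpha a k) ->
  (forall z, in_disc z -> F z = (blaschke_partial J alpha k z * ev (strip J alpha a k) z)%C) ->
  ev (strip J alpha a k) (alpha k) = 0.
Proof.
  intros [HJ HZ] Hk Hl2 HF. pose proof (HJ k Hk) as Hd.
  destruct (HZ _ Hd) as (l & Hnd & Hl & v & Hv & _ & HFv).
  destruct (blaschke_partial_order J alpha k (alpha k) HJ Hd) as (l' & u & Hnd' & Hl' & Hu & Hune & Huc).
  apply (order_gap_zero _ u v (alpha k) (length l') (length l)); try assumption.
  (* The indices in [l'] are below [k], so adding [k] keeps the list free of duplicates, and all of
     it lies in the list [l] that counts the multiplicity. *)
  - change (length (k :: l') <= length l)%nat. apply NoDup_incl_length.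
    + constructor; [|exact Hnd']. intros Hi. apply Hl' in Hi. lia.
    + intros j [Hj|Hj]; apply Hl; [subst; split; auto|]. apply Hl' in Hj. tauto.
  - intros w Hw Hcv. apply (taylor_continuous _ (strip J alpha a k)); try assumption.
    intros z Hz. apply l2_pser; assumption.
  - intros z Hz. rewrite <- Hu, <- HF, <- HFv by assumption. reflexivity.
Qed.

(** Both claims go through one induction: the factorization at stage [k] yields the zero at
    [alpha k], which makes the next quotient exist and be square-summable. *)
Lemma strip_factor F J alpha a : lists_zeros F J alpha -> has_taylor F a -> l2 a ->
  forall k, l2 (strip J alpha a k) /\
  forall z, in_disc z -> F z = (blaschke_partial J alpha k z * ev (strip J alpha a k) z)%C.
Proof.
  intros HZ HF Ha. induction k as [|k [IH1 IH2]].
  - split; [exact Ha|]. intros z Hz. simpl.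
    rewrite (pser_unique a z (F z) (ev a z)); [ring | apply HF, Hz | apply l2_pser; assumption].
  - simpl. destruct (in_index J k) eqn:EJ.
    + pose proof (proj1 HZ k EJ) as Hd.
      destruct (quot_spec (alpha k) (strip J alpha a k) IH1 Hd (strip_zero F J alpha a k HZ EJ IH1 IH2)) as [Hq Eq].
      split; [apply l2_lin, Hq|]. intros z Hz.
      rewrite (ev_lin _ _ _ _ z Hq Hz (fun n => eq_refl)), IH2 by exact Hz.
      rewrite (ev_lin _ _ _ _ z Hq Hz Eq).
      replace (1 * z + - alpha k)%C with (z - alpha k)%C by ring.
      rewrite <- (blaschke_factor_unim (alpha k) z Hd Hz). ring.
    + split; [exact IH1|]. intros z Hz. rewrite IH2 by exact Hz. ring.
Qed.

Lemma strip_quot F J alpha a : lists_zeros F J alpha -> has_taylor F a -> l2 a ->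
  forall k, in_index J k = true -> l2 (quot (alpha k) (strip J alpha a k)) /\
    forall n, strip J alpha a k n = lin 1 (- alpha k) (quot (alpha k) (strip J alpha a k)) n.
Proof.
  intros HZ HF Ha k Hk. destruct (strip_factor F J alpha a HZ HF Ha k) as [H1 H2].
  apply quot_spec; [exact H1 | apply (proj1 HZ), Hk | apply (strip_zero F); assumption].
Qed.

(** The zero is known at stage [i + k] and is carried back to stage [k]: undoing one step replaces
    the factor 1 - conj(alpha k) z, which has no zero in the disc, by z - alpha k. *)
Lemma strip_ev_zero F J alpha a : lists_zeros F J alpha -> has_taylor F a -> l2 a ->
  forall k i, in_index J (i + k) = true -> ev (strip J alpha a k) (alpha (i + k)%nat) = 0.
Proof.
  intros HZ HF Ha k i. revert k. induction i as [|i IH]; intros k Hk.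
  - destruct (strip_factor F J alpha a HZ HF Ha k) as [H1 H2]. apply (strip_zero F); assumption.
  - pose proof (proj1 HZ _ Hk) as Hd.
    replace (S i + k)%nat with (i + S k)%nat in * by lia. specialize (IH (S k) Hk).
    simpl in IH. destruct (in_index J k) eqn:EJ; [|exact IH].
    pose proof (proj1 HZ _ EJ) as Hdk.
    destruct (strip_quot F J alpha a HZ HF Ha k EJ) as [Hq Eq].
    rewrite (ev_lin _ _ _ _ _ Hq Hd (fun n => eq_refl)) in IH.
    rewrite (ev_lin _ _ _ _ _ Hq Hd Eq).
    rewrite (Cmult_cancel _ (ev (quot (alpha k) (strip J alpha a k)) (alpha (i + S k)%nat)) 0
               (unim_lin_neq0 _ _ Hdk Hd)); [ring|].
    rewrite IH. ring.
Qed.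

(** The exact norm drop at a zero involves the quotient of the stripped function, while the theorem
    uses the quotient of F. [wnorm_blaschke_le], applied once per removed factor, compares the
    two. *)
Lemma strip_quot_le F J alpha a w W : lists_zeros F J alpha -> has_taylor F a -> l2 a ->
  (forall n, Rabs (w n) <= W) -> (forall n, w (S n) <= w n) ->
  forall k i, in_index J (i + k) = true ->
  wnorm w (quot (alpha (i + k)%nat) (strip J alpha a k))
  <= wnorm w (quot (alpha (i + k)%nat) (strip J alpha a (i + k))).
Proof.
  intros HZ HF Ha HW Hdec k i. revert k. induction i as [|i IH]; intros k Hk; [apply Rle_refl|].
  replace (S i + k)%nat with (i + S k)%nat in * by lia.
  eapply Rle_trans; [|apply IH, Hk].
  assert (Hk' : in_index J (S i + k) = true) by (rewrite <- Hk; f_equal; lia).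
  set (be := alpha (i + S k)%nat).
  assert (Hbe : alpha (S i + k)%nat = be) by (unfold be; f_equal; lia).
  assert (Hd : in_disc be) by (apply (proj1 HZ); exact Hk).
  destruct (quot_spec be (strip J alpha a k)) as [Hq1 E1].
  { apply (strip_factor F J alpha a HZ HF Ha k). } { exact Hd. }
  { rewrite <- Hbe. apply (strip_ev_zero F); assumption. }
  destruct (quot_spec be (strip J alpha a (S k))) as [Hq2 E2].
  { apply (strip_factor F J alpha a HZ HF Ha (S k)). } { exact Hd. }
  { apply (strip_ev_zero F); assumption. }
  destruct (in_index J k) eqn:EJ; [|simpl; rewrite EJ; apply Rle_refl].
  destruct (strip_quot F J alpha a HZ HF Ha k EJ) as [Hq Eq].
  apply (wnorm_blaschke_le w W (alpha k) (unim (alpha k))); try assumption.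
  - apply (proj1 HZ), EJ.
  - apply Cmod_unim.
  (* The relation between the two quotients at [be] is checked after multiplying by [z - be], where
     both sides become the same three-factor product with the quotient of stage [k] at [alpha k]. *)
  - assert (H1 : RtoC 1 <> 0) by (apply Cmod1_neq0, Cmod_1).
    apply (lin_inj 1 (- be)); [left; exact H1|]. intros n.
    rewrite lin_comm, <- (lin_ext _ _ _ _ E1), (lin_ext _ _ _ _ Eq), lin_comm, (lin_comm 1 (- be)).
    rewrite <- (lin_ext 1 (- alpha k) _ _ E2). apply lin_ext. intros m. simpl. rewrite EJ. reflexivity.
Qed.

(** * Coefficients of the divided functions, and the limit of the stripped ones *)

Lemma analytic_taylor f : analytic f -> has_taylor f (taylor f).
Proof. apply (epsilon_spec (inhabits (fun _ => RtoC 0)) (has_taylor f)). Qed.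

(** Links the function chosen in [divided] with the quotient at coefficient level: [ev h] shows that
    the choice is possible, and multiplying back by [z - al] shows that its coefficients are
    forced. *)
Lemma taylor_divided F a al h : has_taylor F a -> in_disc al -> l2 h ->
  (forall n, a n = lin 1 (- al) h n) -> forall n, taylor (divided F al) n = h n.
Proof.
  intros HF Hal Hh E.
  assert (HFh : forall z, in_disc z -> F z = ((z - al) * ev h z)%C).
  { intros z Hz. replace (z - al)%C with (1 * z + - al)%C by ring.
    apply (pser_unique a z); [apply HF, Hz|].
    apply (pser_ext (lin 1 (- al) h)); [intros; symmetry; apply E|]. apply pser_lin, l2_pser; assumption. }
  destruct (epsilon_spec (inhabits F) (fun h => analytic h /\
       forall z : C, in_disc z -> z <> al -> h z = (F z / (z - al))%C)) as [Hd1 Hd2].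
  { exists (ev h). split.
    - exists h. intros z Hz. apply l2_pser; assumption.
    - intros z Hz Hne. rewrite HFh by exact Hz. field. intros E0. apply Hne, Cminus_eq0, E0. }
  fold (divided F al) in Hd1, Hd2.
  pose proof (analytic_taylor _ Hd1) as Ht.
  assert (H1 : RtoC 1 <> 0) by (apply Cmod1_neq0, Cmod_1).
  apply (lin_inj 1 (- al)); [left; exact H1|]. intros n. rewrite <- E.
  apply (taylor_unique F); [|exact HF]. intros z Hz.
  replace (F z) with ((1 * z + - al) * divided F al z)%C; [apply pser_lin, Ht, Hz|].
  (* At [al] nothing is known about the value of [divided F al], but both sides of the product
     formula are 0 there. *)
  destruct (Ceq_dec z al) as [Ez|Ez].
  - rewrite (HFh z Hz), Ez. ring.
  - rewrite Hd2 by assumption. field. intros E0. apply Ez, Cminus_eq0, E0.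
Qed.

Lemma wnorm_strip_step F J alpha a w W : lists_zeros F J alpha -> has_taylor F a -> l2 a ->
  (forall n, Rabs (w n) <= W) -> forall k,
  wnorm w (strip J alpha a (S k)) = wnorm w (strip J alpha a k)
  - (if in_index J k then (1 - Cmod (alpha k) ^ 2) *
       wnorm (fun n => w (S n) - w n) (quot (alpha k) (strip J alpha a k)) else 0).
Proof.
  intros HZ HF Ha HW k. simpl strip. destruct (in_index J k) eqn:EJ; [|ring].
  destruct (strip_quot F J alpha a HZ HF Ha k EJ) as [Hq Eq].
  rewrite <- (wnorm_lin_identity w W _ (unim (alpha k))) by (try apply Cmod_unim; assumption).
  rewrite <- (wnorm_ext w _ _ Eq). ring.
Qed.

(** For the constant weight the increments vanish, so no step changes the H^2-norm, and this norm
    controls every single coefficient. *)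
Lemma strip_coef_bound F J alpha a : lists_zeros F J alpha -> has_taylor F a -> l2 a ->
  exists K, forall n k, Cmod (strip J alpha a n k) <= K.
Proof.
  intros HZ HF Ha. set (one := fun _ : nat => 1).
  assert (H1 : forall n : nat, Rabs (one n) <= 1) by (intros; unfold one; rewrite Rabs_R1; lra).
  assert (HN : forall n, wnorm one (strip J alpha a n) = wnorm one a).
  { induction n as [|n IH]; [reflexivity|].
    rewrite (wnorm_strip_step F J alpha a one 1 HZ HF Ha H1 n), IH.
    destruct (in_index J n); [|ring]. unfold wnorm at 2.
    rewrite (Series_ext _ (fun k => 0 * Cmod (quot (alpha n) (strip J alpha a n) k) ^ 2))
      by (intros; unfold one; ring).
    rewrite Series_scal_l. ring. }
  exists (1 + wnorm one a). intros n k. rewrite <- (HN n).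
  assert (Hs : 1 * Cmod (strip J alpha a n k) ^ 2 <= wnorm one (strip J alpha a n)).
  { apply (Rle_trans _ (sum_n (fun k => one k * Cmod (strip J alpha a n k) ^ 2) k)).
    - destruct k; [rewrite sum_O; unfold one; lra|]. rewrite sum_Sn. change plus with Rplus. unfold one at 2.
      assert (0 <= sum_n (fun k => one k * Cmod (strip J alpha a n k) ^ 2) k); [|lra].
      induction k; [rewrite sum_O|rewrite sum_Sn; change plus with Rplus];
      unfold one at 1; pose proof Cmod_sq_ge0; [specialize (H (strip J alpha a n 0%nat)); lra|].
      specialize (H (strip J alpha a n (S k))). unfold one in *. lra.
    - apply sum_n_le_Series.
      + intros j. unfold one. pose proof (Cmod_sq_ge0 (strip J alpha a n j)). lra.
      + apply (l2_weight one 1 _ H1), (strip_factor F J alpha a HZ HF Ha n). }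
  pose proof (Cmod_ge_0 (strip J alpha a n k)). nra.
Qed.

Lemma strip_limit F B G J alpha a : lists_zeros F J alpha -> has_taylor F a -> l2 a ->
  (exists z, in_disc z /\ F z <> 0) -> blaschke_decomposition F J alpha B G ->
  exists c, Cmod c = 1 /\ forall k, cv (fun n => strip J alpha a n k) (c * taylor G k)%C.
Proof.
  intros HZ HF Ha Hne ((c & Hc & HB) & (HGa & HG2) & HGne & HFBG).
  pose proof (Cmod1_neq0 _ Hc) as Hc0.
  exists c. split; [exact Hc|].
  destruct (strip_coef_bound F J alpha a HZ HF Ha) as [K1 HK1].
  destruct (l2_bounded (taylor G) HG2) as [K2 HK2].
  assert (Hlim : forall k, cv (fun n => strip J alpha a n k - c * taylor G k)%C 0).
  { apply (coef_limit _ (K1 + K2) 1); [lra| |].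
    - intros n k. rewrite pow1, Rmult_1_r. unfold Cminus. eapply Rle_trans; [apply Cmod_triangle|].
      rewrite Cmod_opp, Cmod_mult, Hc, Rmult_1_l. apply Rplus_le_compat; [apply HK1 | apply HK2].
    - intros rho Hr. destruct (taylor_nonvanishing F a HF Hne rho Hr) as (z & Hz & Hd & HFz).
      exists z, (fun n => ev (strip J alpha a n) z - c * G z)%C. split; [exact Hz|]. split.
      + intros n. apply pser_minus.
        * apply l2_pser; [|exact Hd]. apply (strip_factor F J alpha a HZ HF Ha n).
        * exact (is_pseries_scal c _ z _ (Cmult_comm _ _) (analytic_taylor G HGa z Hd)).
      + replace (RtoC 0) with (c * G z - c * G z)%C by ring.
        apply cv_minus; [|apply cv_const].
        assert (Hbp : forall n, (c * blaschke_partial J alpha n z)%C <> 0).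
        { intros n E. apply HFz. rewrite (proj2 (strip_factor F J alpha a HZ HF Ha n) z Hd).
          rewrite <- (Cmult_cancel c 0 (blaschke_partial J alpha n z) Hc0); [ring|]. rewrite E. ring. }
        assert (HBz : B z <> 0).
        { intros E. apply HFz. rewrite HFBG, E by exact Hd. ring. }
        (* The constant [c] of [is_blaschke] is placed in numerator and denominator, since only the
           products [c * blaschke_partial J alpha n z] are known to tend to [B z]; the limit of the
           quotients is thus [c * G z]. *)
        apply (cv_ext (fun n => (c * F z) * / (c * blaschke_partial J alpha n z))%C).
        * intros n. rewrite (proj2 (strip_factor F J alpha a HZ HF Ha n) z Hd) at 1.
          field. split; [|exact Hc0]. intros E. apply (Hbp n). rewrite E. ring.
        * replace (c * G z)%C with ((c * F z) * / B z)%C.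
          -- apply cv_scal, cv_inv; [exact HBz | exact Hbp|]. apply cv_filterlim, HB, Hd.
          -- rewrite HFBG by exact Hd. field. exact HBz. }
  intros k. pose proof (cv_plus _ _ _ _ (Hlim k) (cv_const (c * taylor G k)%C)) as E.
  rewrite Cplus_0_l in E. revert E. apply cv_ext. intros n. ring.
Qed.

Theorem theorem6 (gamma : nat -> R) (M : R)
  (F B G : C -> C) (J : option nat) (alpha : nat -> C)
  (gamma_monotone : forall n, gamma n <= gamma (S n))
  (gamma_bounded : exists K : R, forall n, Rabs (gamma n) <= K)
  (gamma_nonzero : exists n, gamma n <> 0)
  (gamma_0 : gamma 0%nat = 0)
  (gamma_lim : is_lim_seq gamma M)
  (gamma_concave :
     forall n, gamma (n + 2)%nat - 2 * gamma (n + 1)%nat + gamma n <= 0)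
  (gamma_summable : ex_series (fun n => M - gamma n))
  (F_hardy : hardy2 F)
  (F_nonzero : exists z : C, in_disc z /\ F z <> RtoC 0)
  (alpha_zeros : lists_zeros F J alpha)
  (alpha_increasing : increasing_modulus J alpha)
  (decomposition : blaschke_decomposition F J alpha B G) :
  ex_series (zero_term gamma F J alpha) /\
  normX2 gamma G <= normX2 gamma F - Series (zero_term gamma F J alpha).
Proof.
  destruct F_hardy as [HFa Ha]. pose proof (analytic_taylor F HFa) as HF.
  set (a := taylor F) in *. destruct gamma_bounded as [W HW].
  set (w := fun n => gamma (S n) - gamma n).
  assert (Hw0 : forall n, 0 <= w n) by (intros n; unfold w; specialize (gamma_monotone n); lra).
  assert (HwW : forall n, Rabs (w n) <= W + W).
  { intros n. unfold w, Rminus. eapply Rle_trans; [apply Rabs_triang|]. rewrite Rabs_Ropp.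
    apply Rplus_le_compat; apply HW. }
  assert (Hwdec : forall n, w (S n) <= w n).
  { intros n. unfold w. specialize (gamma_concave n).
    replace (n + 2)%nat with (S (S n)) in gamma_concave by lia.
    replace (n + 1)%nat with (S n) in gamma_concave by lia. lra. }
  assert (Hg0 : forall n, 0 <= gamma n).
  { induction n as [|n IH]; [lra|]. specialize (gamma_monotone n). lra. }
  set (A := strip J alpha a).
  assert (HA : forall n, l2 (A n)) by (intros n; apply (strip_factor F J alpha a alpha_zeros HF Ha n)).
  assert (Hr : forall k, in_index J k = true -> 0 <= 1 - Cmod (alpha k) ^ 2).
  { intros k Hk. pose proof (proj1 alpha_zeros k Hk) as Hd. unfold in_disc in Hd.
    pose proof (Cmod_ge_0 (alpha k)). nra. }
  assert (Hterm : forall k, in_index J k = true ->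
     zero_term gamma F J alpha k = (1 - Cmod (alpha k) ^ 2) * wnorm w (quot (alpha k) a) /\ l2 (quot (alpha k) a)).
  { intros k Hk. pose proof (proj1 alpha_zeros k Hk) as Hd.
    destruct (quot_spec (alpha k) a Ha Hd) as [Hq Eq].
    { pose proof (strip_ev_zero F J alpha a alpha_zeros HF Ha 0 k) as E.
      rewrite Nat.add_0_r in E. apply E, Hk. }
    split; [|exact Hq].
    unfold zero_term. rewrite Hk. f_equal.
    apply (wnorm_ext w). apply (taylor_divided F a); assumption. }
  assert (Hpos : forall k, 0 <= zero_term gamma F J alpha k).
  { intros k. destruct (in_index J k) eqn:EJ; [|unfold zero_term; rewrite EJ; lra].
    destruct (Hterm k EJ) as [E Hq]. rewrite E. apply Rmult_le_pos; [apply Hr, EJ|].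
    apply Series_nonneg; [|apply (l2_weight w (W + W)); assumption].
    intros n. apply Rmult_le_pos; [apply Hw0 | apply Cmod_sq_ge0]. }
  (* The drop is exact with the quotient of stage [k]; replacing it by the quotient of F, whose
     Y-norm is not larger, leaves an inequality. *)
  assert (Hstep : forall k, wnorm gamma (A (S k)) <= wnorm gamma (A k) - zero_term gamma F J alpha k).
  { intros k. unfold A. rewrite (wnorm_strip_step F J alpha a gamma W) by assumption.
    destruct (in_index J k) eqn:EJ; [|unfold zero_term; rewrite EJ; lra].
    destruct (Hterm k EJ) as [E Hq]. rewrite E.
    pose proof (strip_quot_le F J alpha a w (W + W) alpha_zeros HF Ha HwW Hwdec 0 k) as L.
    rewrite Nat.add_0_r in L. specialize (L EJ). simpl strip in L at 1.
    apply Rplus_le_compat_l, Ropp_le_contravar, Rmult_le_compat_l; [apply Hr, EJ | exact L]. }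
  (* [sum_n] includes the index [n], so it pairs with stage [S n]. *)
  assert (Hsum : forall n, wnorm gamma (A (S n)) <= wnorm gamma a - sum_n (zero_term gamma F J alpha) n).
  { induction n as [|n IH].
    - rewrite sum_O. apply (Hstep 0%nat).
    - rewrite sum_Sn. change plus with Rplus. specialize (Hstep (S n)). lra. }
  assert (HgA : forall b, l2 b -> forall N, sum_n (fun k => gamma k * Cmod (b k) ^ 2) N <= wnorm gamma b).
  { intros b Hb N. apply sum_n_le_Series; [|apply (l2_weight gamma W); assumption].
    intros k. apply Rmult_le_pos; [apply Hg0 | apply Cmod_sq_ge0]. }
  assert (Hex : ex_series (zero_term gamma F J alpha)).
  { apply (ex_series_bounded _ (wnorm gamma a)); [exact Hpos|]. intros n. specialize (Hsum n).
    (* As [gamma 0] is 0, the partial sum at index 0 is 0 and gives the nonnegativity of the X-norm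
       of the stripped function; this bounds the partial sums of the zero terms. *)
    pose proof (HgA _ (HA (S n)) 0%nat) as H0. rewrite sum_O, gamma_0 in H0. lra. }
  split; [exact Hex|].
  destruct (strip_limit F B G J alpha a alpha_zeros HF Ha F_nonzero decomposition) as (c & Hc & Hlim).
  (* Fatou's lemma by hand: for fixed [N] the finite sum passes to the limit in the stage [n], with
     [c] dropping out of the moduli, and [N] tends to infinity only afterwards. *)
  assert (HN : forall N, sum_n (fun k => gamma k * Cmod (taylor G k) ^ 2) N
                 <= wnorm gamma a - Series (zero_term gamma F J alpha)).
  { intros N.
    assert (L : is_lim_seq (fun n => sum_n (fun k => gamma k * Cmod (A (S n) k) ^ 2) N)
                  (sum_n (fun k => gamma k * Cmod (taylor G k) ^ 2) N)).
    { apply (is_lim_seq_incr_1 (fun n => sum_n (fun k => gamma k * Cmod (A n k) ^ 2) N)).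
      assert (T : forall k, is_lim_seq (fun n => gamma k * Cmod (A n k) ^ 2) (gamma k * Cmod (taylor G k) ^ 2)).
      { intros k. apply (is_lim_seq_scal_l _ (gamma k) (Cmod (taylor G k) ^ 2)).
        pose proof (cv_Cmod _ _ (cv_pow _ _ 2 (Hlim k))) as L.
        rewrite Cmod_pow, Cmod_mult, Hc, Rmult_1_l in L.
        apply (is_lim_seq_ext _ _ _ (fun n => Cmod_pow _ 2)), L. }
      induction N as [|N IH].
      - rewrite sum_O. apply (is_lim_seq_ext (fun n => gamma 0%nat * Cmod (A n 0%nat) ^ 2)); [|apply T].
        intros n. rewrite sum_O. reflexivity.
      - rewrite sum_Sn. apply (is_lim_seq_ext (fun n => sum_n (fun k => gamma k * Cmod (A n k) ^ 2) N + gamma (S N) * Cmod (A n (S N)) ^ 2)).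
        + intros n. rewrite sum_Sn. reflexivity.
        + apply is_lim_seq_plus'; [exact IH | apply T]. }
    apply (is_lim_seq_le _ (fun n => wnorm gamma a - sum_n (zero_term gamma F J alpha) n)
             (sum_n (fun k => gamma k * Cmod (taylor G k) ^ 2) N)
             (wnorm gamma a - Series (zero_term gamma F J alpha))) in L; [exact L| |].
    - intros n. eapply Rle_trans; [apply HgA, HA | apply Hsum].
    - apply is_lim_seq_minus'; [apply is_lim_seq_const | apply (Series_correct _ Hex)]. }
  assert (HG : ex_series (fun k => gamma k * Cmod (taylor G k) ^ 2)).
  { destruct decomposition as (_ & (_ & HG2) & _). apply (l2_weight gamma W); assumption. }
  apply (is_lim_seq_le (sum_n (fun k => gamma k * Cmod (taylor G k) ^ 2))
           (fun _ => wnorm gamma a - Series (zero_term gamma F J alpha))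
           (normX2 gamma G) (wnorm gamma a - Series (zero_term gamma F J alpha)) HN);
    [apply (Series_correct _ HG) | apply is_lim_seq_const].
Qed.
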